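(* Let $(v_0,y_0)\in\mathbb{R}^d\times\mathbb{R}^m$, let $0<r<\infty$, and let $F:B_{d+m}((v_0,y_0),r)\to\mathbb{R}^d$ be Lipschitz continuous with Lipschitz constant $\mathrm{Lip}(F)$ and $F(v_0,y_0)=0$. Assume that $\partial_vF(v_0,y_0)$ is invertible with a bounded inverse. Then for every $$s>1+(\mathrm{Lip}(F)+1)\,\|\partial_vF(v_0,y_0)^{-1}\|_\infty$$ there exist a constant $\eta_s>0$ and a continuous function $g:B_m\big(y_0,\tfrac{\eta_s}{2s}\big)\to B_d(v_0,\eta_s)$ such that: (i) $g(y_0)=v_0$ and $F(g(y),y)=0$ for all $y\in B_m\big(y_0,\tfrac{\eta_s}{2s}\big)$. (ii) $g$ is Lipschitz continuous at $y_0$, i.e. $|g(y)-g(y_0)|\le s\,|y-y_0|$ for all $y\in B_m\big(y_0,\tfrac{\eta_s}{2s}\big)$. (iii) The following estimate holds: $$\eta_s\ \ge\ \frac12\,\delta\Big(\frac{s-1}{\mathrm{Lip}(F)+1};\ \partial_vF,\ (v_0,y_0)\Big).$$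
   Context: $|\cdot|$ is the Euclidean norm; $B_q(x,t)$ is the open ball in $\mathbb{R}^q$ with center $x$ and radius $t$, with the convention $B_q(x,0)=\{x\}$. For a matrix $O$, $\|O\|:=\max_{|x|=1}|Ox|$. For a bounded set $V$ of matrices, $\|V\|_\infty:=\sup_{v\in V}\|v\|$. A set $V$ of square matrices is invertible if each of its elements is, and $V^{-1}:=\{v^{-1}:v\in V\}$. For $f:\Omega\to\mathbb{R}^p$, $\Omega\subset\mathbb{R}^q$ open, Lipschitz near $x\in\Omega$, the (Clarke) generalized Jacobian $\partial f(x)$ is the convex hull of the set of all $P\in\mathbb{R}^{p\times q}$ of the form $P=\lim_h\frac{\partial f}{\partial x}(x_h)$ with $x_h\to x$ and $f$ differentiable at every $x_h$. For $F$ as in the claim, the generalized partial Jacobian is $$\partial_vF(v,y):=\{P\in\mathbb{R}^{d\times d}:\ \exists\,Q\in\mathbb{R}^{d\times m}\text{ such that }[P,Q]\in\partial F(v,y)\}.$$ The function $\delta(\lambda;S,x)$: let $S$ be a set-valued map defined on the open ball $B_q(x,r)\subset\mathbb{R}^q$, with values subsets of $\mathbb{R}^{p\times p}$, upper semicontinuous at $x$, with $S(x)$ compact, convex and invertible with bounded inverse. For $t\in[0,r)$ put $\phi(t;S,x):=\mathrm{co}\{S(B_q(x,t))\}$ (convex hull of $\bigcup_{z\in B_q(x,t)}S(z)$; in particular $\phi(0;S,x)=S(x)$). For $\lambda>\|S(x)^{-1}\|_\infty$, $$\delta(\lambda;S,x):=\sup\{\delta\in(0,r]:\ \text{for all }t\in[0,\delta),\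 \phi(t;S,x)\text{ is invertible and }\|\phi(t;S,x)^{-1}\|_\infty\le\lambda\}.$$ In the claim this is used with $S=\partial_vF$, $q=d+m$, $p=d$, $x=(v_0,y_0)$ and the radius $r$ of the ball on which $F$ is given. *)

(* Defs.v *)
From HB Require Import structures.
From mathcomp Require Import all_boot all_order all_algebra.
From mathcomp Require Import all_classical all_reals all_analysis.

Set Implicit Arguments.
Unset Strict Implicit.
Unset Printing Implicit Defensive.
Import Order.TTheory GRing.Theory Num.Theory.
Import numFieldNormedType.Exports.
Local Open Scope classical_set_scope.
Local Open Scope ring_scope.

(* Points of R^q are row vectors, as in the library's [jacobian].  A matrix O
   with p rows and q columns still stands for the linear map R^q -> R^p that
   sends a column x to O x; on rows this is x |-> x *m O^T. *)

(* The norm `|x| that the library puts on matrices is the max norm. *)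
Definition enorm (R : realType) (q : nat) (x : 'rV[R]_q) : R :=
  Num.sqrt (\sum_(i < q) x 0 i ^+ 2).

Definition eball (R : realType) (q : nat) (x : 'rV[R]_q) (t : R) :
    set 'rV[R]_q :=
  if t == 0 then [set x] else [set z | enorm (z - x) < t].

(* The supremum is a maximum when q > 0; for q = 0 it is sup set0 = 0. *)
Definition opnorm (R : realType) (p q : nat) (O : 'M[R]_(p, q)) : R :=
  sup [set enorm (x *m O^T) | x in [set x : 'rV[R]_q | enorm x = 1]].

Definition mxset_bounded (R : realType) (p q : nat) (V : set 'M[R]_(p, q)) :
    Prop :=
  has_ubound [set opnorm v | v in V].

(* Meaningful for bounded V only: [sup] is 0 on unbounded sets. *)
Definition mxset_norm (R : realType) (p q : nat) (V : set 'M[R]_(p, q)) : R :=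
  sup [set opnorm v | v in V].

Definition mxset_invertible (R : realType) (p : nat) (V : set 'M[R]_p) : Prop :=
  forall v, V v -> v \in unitmx.

Definition mxset_inv (R : realType) (p : nat) (V : set 'M[R]_p) :
    set 'M[R]_p :=
  [set invmx v | v in V].

Definition convex_hull (R : realType) (E : lmodType R) (A : set E) : set E :=
  smallest (@convex_set R E) A.

(* Only the values of f near x matter, so a function given on an open set may
   be extended arbitrarily.  The library's [jacobian] acts on rows from the
   right, hence the transpose: the (i, j) entry of the matrix below is the
   j-th partial derivative of the i-th component. *)
Definition gen_jacobian (R : realType) (q p : nat)
    (f : 'rV[R]_q -> 'rV[R]_p) (x : 'rV[R]_q) : set 'M[R]_(p, q) :=
  convex_hull [set P : 'M[R]_(p, q) |
    exists x_ : nat -> 'rV[R]_q,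
      [/\ x_ @ \oo --> x,
          forall h, differentiable f (x_ h)
        & (fun h => (jacobian f (x_ h))^T) @ \oo --> P]].

(* The point (v, y) of R^d x R^m is [row_mx v y]. *)
Definition gen_partial_jacobian (R : realType) (d m : nat)
    (F : 'rV[R]_(d + m) -> 'rV[R]_d) (z : 'rV[R]_(d + m)) : set 'M[R]_d :=
  [set P | exists Q : 'M[R]_(d, m), gen_jacobian F z (row_mx P Q)].

Definition hull_on_ball (R : realType) (q p : nat)
    (S : 'rV[R]_q -> set 'M[R]_p) (x : 'rV[R]_q) (t : R) : set 'M[R]_p :=
  convex_hull (\bigcup_(z in eball x t) S z).

(* r is the radius of the ball around x on which S is given. *)
Definition delta (R : realType) (q p : nat) (r lambda : R)
    (S : 'rV[R]_q -> set 'M[R]_p) (x : 'rV[R]_q) : R :=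
  sup [set e | 0 < e <= r /\
    forall t, 0 <= t < e ->
      let phi := hull_on_ball S x t in
      [/\ mxset_invertible phi, mxset_bounded (mxset_inv phi)
        & mxset_norm (mxset_inv phi) <= lambda]].

Definition lipschitz_const_on (R : realType) (q p : nat) (L : R)
    (A : set 'rV[R]_q) (f : 'rV[R]_q -> 'rV[R]_p) : Prop :=
  0 <= L /\ forall z w, A z -> A w -> enorm (f z - f w) <= L * enorm (z - w).

(* Main.v *)
Require Import Defs.
From HB Require Import structures.
From mathcomp Require Import all_boot all_order all_algebra.
From mathcomp Require Import all_classical all_reals all_analysis.
From mathcomp Require Import measurable_realfun ring lra.

Set Implicit Arguments.
Unset Strict Implicit.
Unset Printing Implicit Defensive.
Import Order.TTheory GRing.Theory Num.Theory.
Import numFieldNormedType.Exports.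
Local Open Scope classical_set_scope.
Local Open Scope ring_scope.

(* Almost everywhere differentiability of a Lipschitz map F on R^n
   (Rademacher) is obtained by adding one coordinate at a time: at almost every
   point F is differentiable along the new coordinate line (monotone Lipschitz
   functions have Stieltjes measures with a Lebesgue density) and, by induction,
   in the remaining coordinates, and the set where the latter approximation
   holds at a fixed scale has density 1 along the new line, which glues the two.
   Integrating along almost every segment parallel to w bounds F(z + w) - F(z)
   by the Jacobians at differentiability points.

   For t < delta, the hull of the partial Jacobians over the t-ball is convex
   and consists of matrices P with |u| <= lam |P u|, lam = (s - 1)/(Lip F + 1).
   Separating {P u} from the origin gives a direction xi with
   <xi, P u> >= |u| / lam for all P at once, so that the mean value inequality
   yields |v - v'| <= lam |F(v, y) - F(v', y)|.  Separating {P^T xi} gives a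
   descent direction for |F(., y)|, so a minimizer over a closed ball about v0
   is a zero as soon as it is interior.  Taking eta = delta / 2 keeps all the
   points involved in the ball of radius (3/4) delta. *)

(** * Lipschitz functions of one real variable *)

(** A segment can lie entirely inside the null set where [F] is not differentiable, so a mean value
    inequality cannot be read off on the segment itself; almost every parallel segment is good by
    Fubini, and continuity brings the bound back. Hence Rademacher's theorem is used with a measure,
    not merely as density of the differentiability points. Since one direction [xi] serves every
    [P], only the scalar product of [F] with [xi] is integrated along the segment. The choice of
    [lam] has two sides. The hypothesis on [s] says exactly that [lam] exceeds the norm of the
    inverse at the base point; this strict gap makes [delta] positive, by compactness of the unit
    sphere and of bounded sets of Jacobians. On the other side [lam * LipF <= s - 1], so comparing
    the zeros for [y] and [y'] gives [g] the Lipschitz constant [s - 1]; with the radius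
    [eta / (2 * s)] the same inequality gives [2 * lam * |F(v0, y)| < eta], which forces the
    minimizer into the interior. *)

Lemma lipschitz_continuous (R : realType) (V W : normedModType R) (f : V -> W) (L : R) :
  (forall x y, `|f x - f y| <= L * `|x - y|) -> continuous f.
Proof.
move=> f_lip x; apply/cvgrPdist_le => e e0.
have L1 : 0 < `|L| + 1 by rewrite ltr_wpDl.
near=> y; apply: le_trans (f_lip _ _) _.
apply: (@le_trans _ _ ((`|L| + 1) * `|x - y|)).
  by rewrite ler_wpM2r// (le_trans (ler_norm L))// lerDl.
rewrite mulrC -ler_pdivlMr//.
by near: y; apply: cvgr_dist_le; [exact: cvg_id|rewrite divr_gt0].
Unshelve. all: by end_near. Qed.

Lemma lebesgue_stieltjes_measure_itv (R : realType) (G : cumulative R R) (a b : R) :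
  a <= b -> lebesgue_stieltjes_measure G `]a, b]%classic = (G b - G a)%:E.
Proof.
move=> ab; rewrite /lebesgue_stieltjes_measure /measure_extension.
by rewrite measurable_mu_extE/= ?wlength_itv_bnd//; exact: is_ocitv.
Qed.

(** Both measures are infima over the same countable covers by half-open intervals, so a cover of
    total length below [e / C'] bounds the Stieltjes measure by [e]. *)
Lemma lipschitz_stieltjes_null (R : realType) (G : cumulative R R) (C : R) :
  (forall x y, x <= y -> G y - G x <= C * (y - x)) ->
  lebesgue_stieltjes_measure G `<< (@lebesgue_measure R).
Proof.
move=> GC; apply/null_content_dominatesP => A mA A0.
(* [C] may vanish; a positive constant is needed for the division [e / C']. *)
have [C' [C'0 GC']] : exists C' : R, 0 < C' /\
    forall x y, x <= y -> G y - G x <= C' * (y - x).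
  exists (Num.max C 1); split; first by rewrite lt_max ltr01 orbT.
  move=> x y xy; apply: le_trans (GC _ _ xy) _.
  by rewrite ler_wpM2r ?subr_ge0// le_max lexx.
apply/eqP; rewrite eq_le measure_ge0 andbT; apply/lee_addgt0Pr => e e0.
rewrite add0e.
have eC0 : 0 < e / C' by rewrite divr_gt0.
have : (ereal_inf [set \sum_(k <oo) wlength idfun (B k) | B in measurable_cover (A : set (ocitv_type R))]
   < (e / C')%:E)%E.
  rewrite (_ : ereal_inf _ = lebesgue_measure A); first by rewrite A0 lte_fin.
  by [].
move=> /ereal_inf_lt[_ [B [mB AB] <-]] Be.
apply: (@le_trans _ _ (\sum_(k <oo) wlength G (B k))%E).
  by rewrite /lebesgue_stieltjes_measure /measure_extension/=; apply: ereal_inf_lbound; exists B.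
apply: (@le_trans _ _ (\sum_(k <oo) (C'%:E * wlength idfun (B k)))%E).
  apply: lee_nneseries => [i _ _|i _]; first by rewrite wlength_ge0.
  have [[x y] _ <-]/= := mB i.
  have [xy|xy] := leP x y.
    by rewrite !wlength_itv_bnd//= -EFinM lee_fin GC'.
  rewrite set_itv_ge; last by rewrite bnd_simp -leNgt ltW.
  have wl0 (H : cumulative R R) : wlength H (set0 : set R) = 0 by exact: wlength0.
  by rewrite wl0 [X in (_ <= _ * X)%E](wl0 idfun) mule0.
rewrite nneseriesZl; last by move=> i _; rewrite wlength_ge0.
apply: (@le_trans _ _ (C'%:E * (e / C')%:E)%E).
  by rewrite lee_pmul2l ?lte_fin// ltW.
by rewrite -EFinM mulrCA divff ?mulr1// gt_eqF.
Qed.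

(** Radon-Nikodym applied to the Stieltjes measure of [g] yields [rho]; the fundamental theorem of
    calculus for Lebesgue integrals identifies it with the derivative almost everywhere. *)
Lemma monotone_lipschitz_density (R : realType) (g : R -> R) (C a b : R) :
  {homo g : x y / x <= y} -> (forall x y, `|g x - g y| <= C * `|x - y|) ->
  a < b ->
  exists rho : R -> R, [/\ lebesgue_measure.-integrable setT (EFin \o rho),
    forall x, a <= x <= b ->
      (g x - g a)%:E = (\int[lebesgue_measure]_(t in `]a, x]) (rho t)%:E)%E &
    {ae lebesgue_measure, forall x, a < x < b ->
      derivable g x 1 /\ derive1 g x = rho x}].
Proof.
move=> g_nd g_lip ab.
have g_rc : right_continuous g.
  by apply: right_continuousW; exact: (@lipschitz_continuous R R^o R^o g C g_lip).
pose G : cumulative R R := HB.pack_for (cumulative R R) g (isCumulative.Build R _ R g g_nd g_rc).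
pose mu := @lebesgue_measure R.
have mab : measurable (`]a, b]%classic : set (measurableTypeR R)) by exact: measurable_itv.
have fin_ab : (lebesgue_stieltjes_measure G `]a, b]%classic < +oo)%E.
  by rewrite (lebesgue_stieltjes_measure_itv _ (ltW ab)) ltry.
(* Cutting down to []a, b]] makes the Stieltjes measure finite, as Radon-Nikodym requires. *)
pose nu : {finite_measure set (measurableTypeR R) -> \bar R} :=
  mfrestr mab fin_ab.
have nu_mu : nu `<< mu.
  apply/null_content_dominatesP => A mA A0.
  apply/eqP; rewrite eq_le measure_ge0 andbT.
  have G0 : lebesgue_stieltjes_measure G A = 0.
    have GC x y : x <= y -> G y - G x <= C * (y - x).
      move=> xy; apply: le_trans (ler_norm _) _.
      by apply: le_trans (g_lip _ _) _; rewrite ger0_norm ?subr_ge0.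
    by have /null_content_dominatesP := lipschitz_stieltjes_null GC; exact.
  rewrite -G0 /nu/= /mfrestr /mrestr; apply: le_measure; rewrite ?inE//=.
  exact: measurableI.
have [rho [rho0 rho_fin rho_int rhoE]] := radon_nikodym_sigma_finite nu_mu.
have EFrho : EFin \o (fine \o rho) = rho.
  by apply/funext => x /=; rewrite fineK.
have gE x : a <= x <= b ->
    (g x - g a)%:E = (\int[mu]_(t in `]a, x]) (fine (rho t))%:E)%E.
  move=> /andP[ax xb].
  have -> : (\int[mu]_(t in `]a, x]) (fine (rho t))%:E = \int[mu]_(t in `]a, x]) rho t)%E.
    by apply: eq_integral => t _; rewrite fineK.
  rewrite -rhoE; last exact: measurable_itv.
  rewrite /nu/= /mfrestr /mrestr/= setIidl; last first.
    by apply: subset_itvl; rewrite bnd_simp.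
  by rewrite lebesgue_stieltjes_measure_itv.
exists (fine \o rho); split => //; first by rewrite EFrho.
have rho_int' : mu.-integrable setT (EFin \o (fine \o rho)) by rewrite EFrho.
have rho_loc : locally_integrable setT (fine \o rho).
  by apply: open_integrable_locally => //; exact: openT.
have := @FTC1 R (fine \o rho) (BRight a) _ rho_loc.
have int_y y : mu.-integrable [set` Interval (BRight a) (BRight y)] (EFin \o (fine \o rho)).
  exact: integrableS rho_int'.
move=> /(_ int_y); apply: filterS; first exact: (ae_filter_ringOfSetsType mu).
move=> x /[swap] /andP[ax xb] /=.
rewrite lte_fin => /(_ ax) [dF F'].
(* Near an interior point, [g] is the indefinite integral of the density plus the constant [g a], so
   derivability transfers to [g]. *)
have near_eq : \forall y \near x, \int[mu]_(t in `]a, y]) (fine (rho t)) + g a = g y.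
  near=> y.
  have ay : a <= y <= b.
    by apply/andP; split; apply: ltW; near: y; [exact: lt_nbhsr|exact: lt_nbhsl].
  by rewrite /Rintegral -gE//= subrK.
set Phi := fun y : R => _ in dF F'.
have dPhi : is_derive x 1 Phi (fine (rho x)).
  by apply: DeriveDef; [exact: dF|rewrite -derive1E; exact: F'].
have ga : is_derive x 1 (Phi + cst (g a)) (fine (rho x) + 0).
  exact: is_deriveD.
rewrite addr0 in ga.
have dg : is_derive x 1 g (fine (rho x)) := near_eq_is_derive near_eq ga.
by split; [exact: ex_derive|rewrite derive1E derive_val].
Unshelve. all: by end_near. Qed.

(* Adding the slope C makes h monotone. *)
Lemma lipschitz_density (R : realType) (h : R -> R) (C a b : R) :
  (forall x y, `|h x - h y| <= C * `|x - y|) -> a < b ->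
  exists rho : R -> R, [/\ lebesgue_measure.-integrable setT (EFin \o rho),
    (h b - h a + C * (b - a))%:E = (\int[lebesgue_measure]_(t in `]a, b]) (rho t)%:E)%E &
    {ae lebesgue_measure, forall x, a < x < b ->
      derivable h x 1 /\ derive1 h x + C = rho x}].
Proof.
move=> h_lip ab.
pose g := h + (C *: id : R -> R).
have g_nd : {homo g : x y / x <= y}.
  move=> x y xy; rewrite /g !fctE -subr_ge0.
  have -> : h y + C *: y - (h x + C *: x) = C * (y - x) - (h x - h y).
    by rewrite /GRing.scale/=; ring.
  rewrite subr_ge0; apply: le_trans (ler_norm _) _; apply: le_trans (h_lip _ _) _.
  by rewrite distrC ger0_norm ?subr_ge0.
have g_lip x y : `|g x - g y| <= (C + `|C|) * `|x - y|.
  have -> : g x - g y = (h x - h y) + C * (x - y).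
    by rewrite /g !fctE /GRing.scale/=; ring.
  apply: le_trans (ler_normD _ _) _.
  by rewrite mulrDl lerD// normrM.
have [rho [rho_int gE rhoE]] := monotone_lipschitz_density g_nd g_lip ab.
exists rho; split => //.
  rewrite -gE; last by rewrite lexx ltW.
  by congr EFin; rewrite /g !fctE /GRing.scale/=; ring.
move: rhoE; apply: filterS; first exact: (ae_filter_ringOfSetsType lebesgue_measure).
move=> x rhoE /rhoE[dg <-].
have hE : h = g - (C *: id : R -> R).
  by apply/funext => y; rewrite /g !fctE addrK.
have dx : derivable (C *: id : R -> R) x 1 by apply: derivableZ; exact: derivable_id.
split; first by rewrite hE; exact: derivableB.
rewrite [in LHS]hE !derive1E deriveB// deriveZ; last exact: derivable_id.
by rewrite derive_id /GRing.scale/= mulr1 subrK.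
Qed.

Lemma lipschitz_ae_derivable (R : realType) (h : R -> R) (C : R) :
  (forall x y, `|h x - h y| <= C * `|x - y|) ->
  {ae lebesgue_measure, forall x, derivable h x 1}.
Proof.
move=> h_lip.
have ae_n (n : nat) : {ae lebesgue_measure, forall x, - n.+1%:R < x < n.+1%:R ->
    derivable h x 1}.
  have nn : - n.+1%:R < n.+1%:R :> R by rewrite (@lt_trans _ _ 0) ?oppr_lt0 ?ltr0n.
  have [rho [_ _]] := lipschitz_density h_lip nn.
  apply: filterS; first exact: (ae_filter_ringOfSetsType lebesgue_measure).
  by move=> x + xn => /(_ xn)[].
have := ae_foralln ae_n; apply: filterS.
move=> x /(_ (Num.bound `|x|)); apply; rewrite -ltr_norml.
by rewrite (lt_trans (archi_boundP (normr_ge0 x)))// ltr_nat.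
Qed.

(** A Lipschitz function is the integral of its almost everywhere derivative, so a lower bound on
    the derivative off a null set is enough. *)
Lemma lipschitz_mean_value (R : realType) (h : R -> R) (C a b c : R) :
  (forall x y, `|h x - h y| <= C * `|x - y|) -> a < b ->
  {ae lebesgue_measure, forall x, a < x < b -> derivable h x 1 ->
    c <= derive1 h x} ->
  c * (b - a) <= h b - h a.
Proof.
move=> h_lip ab h_ge.
have [rho [rho_int rhoE drho]] := lipschitz_density h_lip ab.
have mab : measurable (`]a, b]%classic : set (measurableTypeR R)) by exact: measurable_itv.
have [N [mN N0 subN]] : {ae lebesgue_measure, forall x, a < x < b ->
    c + C <= rho x}.
  move: drho h_ge; apply: filterS2; first exact: (ae_filter_ringOfSetsType lebesgue_measure).
  by move=> x dE h_ge axb; have [dh <-] := dE axb; rewrite lerD2r h_ge.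
have moo : measurable (`]a, b[%classic : set (measurableTypeR R)) by exact: measurable_itv.
have rho_ab : lebesgue_measure.-integrable `]a, b[%classic (EFin \o rho).
  exact: integrableS rho_int.
have cst_ab : lebesgue_measure.-integrable `]a, b[%classic (EFin \o cst (c + C)).
  apply/integrableP; split; first exact/measurable_EFinP.
  rewrite /= integral_cst//= lebesgue_measure_itv/= lte_fin ab.
  by rewrite -EFinB -EFinM ltry.
(* The density [rho] belongs to [h] plus the slope [C], hence the extra term on both sides. *)
rewrite -(lerD2r (C * (b - a))) -mulrDl -lee_fin rhoE.
rewrite -integral_itv_bndo_bndc; last exact: measurable_int rho_ab.
have -> := negligible_integral mN moo rho_ab N0.
have := negligible_integral mN moo cst_ab N0.
rewrite [LHS](integral_cst _ moo (c + C)%:E)/= lebesgue_measure_itv/= lte_fin ab.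
rewrite -EFinB -EFinM => ->.
apply: le_integral => //.
- exact: measurableD.
- by apply: integrableS cst_ab => //; exact: measurableD.
- by apply: integrableS rho_ab => //; exact: measurableD.
move=> x; rewrite inE => -[/=]; rewrite in_itv/= => axb Nx.
by rewrite lee_fin; apply: contrapT => cx; apply: Nx; apply: subN => /(_ axb).
Qed.

(** Were an interval of half-width [c * |s|] about [t + s] disjoint from [A], then [A] would fill at
    most the fraction [1 / (1 + c)] of the ball of radius [(1 + c) * |s|] about [t]. At a density
    point this fails for all small [s]. *)
Lemma ae_not_porous (R : realType) (A : set (measurableTypeR R)) (c : R) :
  measurable A -> 0 < c ->
  {ae lebesgue_measure, forall t, A t -> exists2 dl : R, 0 < dl &
    forall s, 0 < `|s| < dl -> exists2 s', `|s' - s| <= c * `|s| & A (t + s')}.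
Proof.
move=> mA c0; have := lebesgue_density mA.
apply: filterS; first exact: (ae_filter_ringOfSetsType lebesgue_measure).
move=> t dens At.
rewrite indicE mem_set//= in dens.
have c1 : ((1 + c)^-1%:E < 1%:E :> \bar R)%E.
  by rewrite lte_fin invf_lt1 ?ltrDl ?addr_gt0.
have [dl /= dl0 dlE] : \forall r \near (0:R)^'+,
  ((1 + c)^-1%:E < lebesgue_measure (A `&` ball t r) * (lebesgue_measure (ball t r))^-1)%E.
  apply: (dens [set x | ((1 + c)^-1%:E < x)%E]); apply: open_nbhs_nbhs.
  by split => //; exact: open_ereal_gt_ereal.
have c1' : 0 < 1 + c by rewrite addr_gt0.
exists (dl / (1 + c)); first by rewrite divr_gt0.
move=> s /andP[s0 sdl]; apply: contrapT => noA.
set r := (1 + c) * `|s|.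
have r0 : 0 < r by rewrite mulr_gt0.
have rdl : r < dl by rewrite /r mulrC -ltr_pdivlMr.
have := dlE r; rewrite /= sub0r normrN gtr0_norm// => /(_ rdl r0).
apply/negP; rewrite -leNgt.
rewrite (lebesgue_measure_ball _ (ltW r0)).
pose I := `]t + s - c * `|s|, t + s + c * `|s|[%classic : set (measurableTypeR R).
have mI : measurable I by exact: measurable_itv.
have mB : measurable (ball t r : set (measurableTypeR R)) by exact: measurable_ball.
have IB : I `<=` ball t r.
  move=> x; rewrite /I /ball/= in_itv/= => /andP[x1 x2].
  have s1 := ler_norm s; have s2 := ler_norm (- s); rewrite normrN in s2.
  rewrite /r ltr_norml; apply/andP; split; lra.
have AB : A `&` ball t r `<=` ball t r `\` I.
  move=> x [Ax Bx]; split => //; rewrite /I/= in_itv/= => /andP[x1 x2].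
  apply: noA; exists (x - t); last by rewrite addrC subrK.
  by rewrite ler_norml; apply/andP; split; lra.
have muI : lebesgue_measure I = (2 * c * `|s|)%:E.
  rewrite /I lebesgue_measure_itv/= lte_fin.
  have cs : 0 < c * `|s| by rewrite mulr_gt0.
  rewrite ifT; last by lra.
  by rewrite -EFinB; congr EFin; ring.
have muA : (lebesgue_measure (A `&` ball t r) <= (2 * `|s|)%:E)%E.
  apply: (@le_trans _ _ (lebesgue_measure (ball t r `\` I))).
    apply: le_measure; rewrite ?inE//; [exact: measurableI|exact: measurableD].
  have muB : lebesgue_measure (ball t r) = (r *+ 2)%:E.
    by rewrite lebesgue_measure_ball ?ltW.
  rewrite measureD//; last by rewrite /= muB ltry.
  rewrite setIidr// /= [X in (_ - X)%E]muI [X in (X - _)%E]muB -EFinB lee_fin.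
  by rewrite /r mulr2n; lra.
rewrite inver gt_eqF ?mulr2n ?addr_gt0//.
apply: (@le_trans _ _ ((2 * `|s|)%:E * (r + r)^-1%:E)%E).
  by apply: lee_wpmul2r => //; rewrite lee_fin invr_ge0 addr_ge0// ltW.
rewrite -EFinM lee_fin /r.
have -> : (1 + c) * `|s| + (1 + c) * `|s| = (2 * `|s|) * (1 + c) by ring.
rewrite invfM mulrA divff ?mul1r//.
by rewrite gt_eqF// mulr_gt0.
Qed.

(** * Differentiability at a fixed scale *)

Lemma mx_entry_le_norm (R : realType) (m n : nat) (x : 'M[R]_(m, n)) i j :
  `|x i j| <= `|x|.
Proof. by rewrite [leRHS]mx_normrE (le_bigmax _ (fun ij => `|x ij.1 ij.2|) (i, j)). Qed.

Lemma mx_norm_le (R : realType) (m n : nat) (x : 'M[R]_(m, n)) (e : R) :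
  0 <= e -> (forall i j, `|x i j| <= e) -> `|x| <= e.
Proof.
by move=> e0 xe; rewrite [leLHS]mx_normrE; apply/bigmax_leP.
Qed.

Lemma mulmx_norm_le (R : realType) (m n p : nat) (A : 'M[R]_(m, n)) (B : 'M[R]_(n, p)) :
  `|A *m B| <= n%:R * `|A| * `|B|.
Proof.
apply: mx_norm_le => [|i j]; first by rewrite !mulr_ge0.
rewrite mxE; apply: le_trans (ler_norm_sum _ _ _) _.
apply: (@le_trans _ _ (\sum_(k < n) `|A| * `|B|)).
  by apply: ler_sum => k _; rewrite normrM ler_pM ?mx_entry_le_norm.
by rewrite sumr_const card_ord -mulrA mulr_natl.
Qed.

Lemma norm_row_mx_r (R : realType) (m n1 n2 : nat) (x : 'M[R]_(m, n2)) :
  `|row_mx (0 : 'M[R]_(m, n1)) x| = `|x|.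
Proof.
apply/eqP; rewrite eq_le; apply/andP; split; apply: mx_norm_le => // i j.
  rewrite mxE; case: splitP => k _; last exact: mx_entry_le_norm.
  by rewrite mxE normr0.
by apply: le_trans (mx_entry_le_norm _ i (rshift n1 j)); rewrite row_mxEr.
Qed.

Lemma norm_row_mx_l (R : realType) (m n1 n2 : nat) (x : 'M[R]_(m, n1)) :
  `|row_mx x (0 : 'M[R]_(m, n2))| = `|x|.
Proof.
apply/eqP; rewrite eq_le; apply/andP; split; apply: mx_norm_le => // i j.
  rewrite mxE; case: splitP => k _; first exact: mx_entry_le_norm.
  by rewrite mxE normr0.
by apply: le_trans (mx_entry_le_norm _ i (lshift n2 j)); rewrite row_mxEl.
Qed.

Lemma norm_scalar_mx1 (R : realType) (t : R) : `|t%:M : 'M[R]_1| = `|t|.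
Proof.
apply/eqP; rewrite eq_le; apply/andP; split.
  by apply: mx_norm_le => // i j; rewrite !ord1 mxE.
by apply: le_trans (mx_entry_le_norm _ 0 0); rewrite mxE.
Qed.

(* Points at which f is, at scale dl and up to the relative error eps, linear
   along the row space of E. *)
Definition slope_set (R : realType) (k n : nat) (f : 'rV[R]_n -> R)
    (E : 'M[R]_(k, n)) (eps dl : R) (a : 'cV[R]_k) : set 'rV[R]_n :=
  [set z | forall h : 'rV_k, `|h| < dl ->
    `|f (z + h *m E) - f z - (h *m a) 0 0| <= eps * `|h|].

(* The slope may depend on eps; it converges as eps tends to 0, so this is
   differentiability of f at z along the row space of E, in a form that is
   visibly a Borel condition on z. *)
Definition quasi_diff (R : realType) (k n : nat) (f : 'rV[R]_n -> R)
    (E : 'M[R]_(k, n)) (z : 'rV[R]_n) : Prop :=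
  forall eps, 0 < eps -> exists2 dl, 0 < dl & exists a, slope_set f E eps dl a z.

Lemma slope_setS (R : realType) (k n : nat) (f : 'rV[R]_n -> R)
    (E : 'M[R]_(k, n)) (eps dl eps' dl' : R) (a : 'cV[R]_k) :
  eps <= eps' -> dl' <= dl -> slope_set f E eps dl a `<=` slope_set f E eps' dl' a.
Proof.
move=> epsE dlE z Dz h hdl; apply: (le_trans (Dz _ (lt_le_trans hdl dlE))).
by rewrite ler_wpM2r.
Qed.

Lemma inv_natS_lt (R : realType) (e : R) : 0 < e -> exists k : nat, k.+1%:R^-1 < e.
Proof.
move=> e0; have [k _ ke] : \forall k \near \oo, k.+1%:R^-1 < e.
  by apply: near_infty_natSinv_lt (PosNum e0).
by exists k; apply: ke => /=.
Qed.

Lemma rat_mx_dense (R : realType) (m n : nat) (x : 'M[R]_(m, n)) (e : R) : 0 < e ->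
  exists q : 'M[rat]_(m, n), `|map_mx ratr q - x| < e.
Proof.
move=> e0.
have e20 : 0 < e / 2 by rewrite divr_gt0.
have rq (i : 'I_m) (j : 'I_n) : exists q : rat, `|ratr q - x i j| < e / 2.
  have [q] := @rat_in_itvoo R (x i j - e / 2) (x i j + e / 2) ltac:(lra).
  rewrite in_itv/= => /andP[q1 q2]; exists q.
  by rewrite ltr_norml; apply/andP; split; lra.
have /choice[q qE] : forall ij : 'I_m * 'I_n, exists q : rat, `|ratr q - x ij.1 ij.2| < e / 2.
  by move=> [i j]; exact: rq.
exists (\matrix_(i, j) q (i, j)); apply: (@le_lt_trans _ _ (e / 2)); last by lra.
apply: mx_norm_le => [|i j]; first exact: ltW.
by rewrite !mxE ltW// (qE (i, j)).
Qed.

(** Restricting errors, scales and slopes to countable families turns the property into a countable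
    combination of closed conditions, hence a measurable one. *)
Lemma quasi_diff_countable (R : realType) (k n : nat) (f : 'rV[R]_n -> R)
    (E : 'M[R]_(k, n)) (z : 'rV[R]_n) :
  quasi_diff f E z <-> forall j : nat, exists (i : nat) (a : 'cV[rat]_k),
    slope_set f E j.+1%:R^-1 i.+1%:R^-1 (map_mx ratr a) z.
Proof.
split=> [qd j|qd eps eps0]; last first.
  have [j jeps] := inv_natS_lt eps0.
  have [i [a Da]] := qd j; exists i.+1%:R^-1; first by rewrite invr_gt0.
  exists (map_mx ratr a); exact: slope_setS (ltW jeps) (lexx _) _ Da.
set e : R := j.+1%:R^-1; have e0 : 0 < e by rewrite invr_gt0.
have [dl dl0 [a Da]] := qd (e / 2) ltac:(lra).
have [i idl] := inv_natS_lt dl0.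
have k0 : 0 < k.+1%:R :> R by [].
(* Half of the error is left to the slope [a], half to its rational rounding [q]; [k.+1] keeps the
   denominator nonzero when [k = 0]. *)
have [q qa] := @rat_mx_dense _ _ _ a (e / (2 * k.+1%:R)) ltac:(by rewrite divr_gt0// mulr_gt0).
exists i, q => h hi.
have hdl : `|h| < dl by apply: lt_trans hi idl.
have -> : f (z + h *m E) - f z - (h *m map_mx ratr q) 0 0 =
   (f (z + h *m E) - f z - (h *m a) 0 0) - (h *m (map_mx ratr q - a)) 0 0.
  have subE (M N : 'M[R]_1) : (M - N) 0 0 = M 0 0 - N 0 0 by rewrite !mxE.
  by rewrite mulmxBr subE; ring.
apply: le_trans (ler_normB _ _) _.
have -> : e * `|h| = e / 2 * `|h| + e / 2 * `|h| by lra.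
apply: lerD; first exact: Da.
apply: le_trans (mx_entry_le_norm _ _ _) _; apply: le_trans (mulmx_norm_le _ _) _.
rewrite mulrAC ler_wpM2r//.
apply: (@le_trans _ _ (k.+1%:R * (e / (2 * k.+1%:R)))).
  by apply: ler_pM => //; [rewrite ler_nat|exact: ltW].
rewrite le_eqVlt; apply/orP; left; apply/eqP.
by have kn : k.+1%:R != 0 :> R by []; field.
Qed.

(** An increment with components [s] and [h] is made in two moves: along the new line to a nearby
    point [z'] of the same set [D], then by [h] from [z']. Because [D] fixes slope, error and scale,
    the slope [a'] found at [z] is valid at [z'] too, which differentiability at [z'] alone would
    not give. *)
Lemma quasi_diff_step (R : realType) (n : nat) (f : 'rV[R]_(1 + n) -> R) (L : R)
    (z : 'rV[R]_(1 + n)) :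
  0 <= L -> (forall x y, `|f x - f y| <= L * `|x - y|) ->
  quasi_diff f (row_mx 1%:M 0 : 'M[R]_(1, 1 + n)) z ->
  quasi_diff f (row_mx 0 1%:M : 'M[R]_(n, 1 + n)) z ->
  (forall (j i : nat) (a : 'cV[rat]_n),
    let D := slope_set f (row_mx 0 1%:M : 'M[R]_(n, 1 + n))
      j.+1%:R^-1 i.+1%:R^-1 (map_mx ratr a) in
    D z -> exists2 dl : R, 0 < dl &
      forall s, 0 < `|s| < dl -> exists2 s', `|s' - s| <= j.+1%:R^-1 * `|s| &
        D (z + row_mx s'%:M 0)) ->
  quasi_diff f 1%:M z.
Proof.
move=> L0 f_lip qd1 qd' nonporous eps eps0.
(* The total error is [eps / 2] along the line, [c] across it, and [L * c] twice for replacing [s]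
   by [s']; hence the bound on [(2 * L + 1) * c]. *)
have L1 : 0 < 2 * (2 * L + 1) by lra.
have [j] := inv_natS_lt (divr_gt0 eps0 L1); set c : R := j.+1%:R^-1 => jc.
have c0 : 0 < c by rewrite invr_gt0.
have cE : (2 * L + 1) * c <= eps / 2.
  by move: jc; rewrite ltr_pdivlMr// => jc; lra.
have /quasi_diff_countable/(_ j) [i [a' Da]] := qd'.
have [dl2 dl20 np] := nonporous _ _ _ Da.
have [dl1 dl10 [a1 Da1]] := qd1 (eps / 2) ltac:(lra).
set dl : R := Num.min (Num.min dl1 dl2) i.+1%:R^-1.
have dl0 : 0 < dl by rewrite !lt_min dl10 dl20 invr_gt0/=.
exists dl => //; exists (col_mx a1 (map_mx ratr a')) => k kdl.
rewrite mulmx1; pose h := rsubmx k; pose s : R := lsubmx k 0 0.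
have sE : lsubmx k = s%:M by rewrite [LHS]mx11_scalar.
have kE : k = row_mx s%:M h by rewrite -sE hsubmxK.
have sk : `|s| <= `|k| by rewrite /s mxE mx_entry_le_norm.
have hk : `|h| <= `|k|.
  by apply: mx_norm_le => // i0 j0; rewrite mxE mx_entry_le_norm.
move: kdl; rewrite !lt_min => /andP[/andP[k1 k2] ki].
have -> : (k *m col_mx a1 (map_mx ratr a')) 0 0 =
    (s%:M *m a1) 0 0 + (h *m map_mx ratr a') 0 0.
  by rewrite {1}kE mul_row_col mxE.
have e1E (t : R) : t%:M *m (row_mx 1%:M 0 : 'M[R]_(1, 1 + n)) = row_mx t%:M 0.
  by rewrite mul_mx_row mulmx1 mulmx0.
have e'E (x : 'rV[R]_n) : x *m (row_mx 0 1%:M : 'M[R]_(n, 1 + n)) = row_mx 0 x.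
  by rewrite mul_mx_row mulmx1 mulmx0.
have k0 := normr_ge0 k.
(* Non-porosity speaks only of nonzero [s]; for [s = 0] the estimate at [z] itself suffices. *)
have [s0|s0] := eqVneq s 0.
  have -> : z + k = z + h *m (row_mx 0 1%:M : 'M[R]_(n, 1 + n)).
    by rewrite e'E {1}kE s0 raddf0.
  rewrite s0 raddf0 mul0mx mxE add0r.
  apply: le_trans (Da h (le_lt_trans hk ki)) _.
  apply: ler_pM => //.
  have : 0 <= L * c by rewrite mulr_ge0// ltW.
  by rewrite -/c; lra.
have s0' : 0 < `|s| < dl2 by rewrite normr_gt0 s0 (le_lt_trans sk).
have [s' s's Ds'] := np s s0'.
have kE2 : row_mx s%:M h = row_mx s%:M 0 + row_mx 0 h by rewrite add_row_mx addr0 add0r.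
have rowB (t t' : R) : row_mx (t - t')%:M (0 : 'rV[R]_n) = row_mx t%:M 0 - row_mx t'%:M 0.
  by rewrite opp_row_mx add_row_mx oppr0 addr0 raddfB.
have zK (x S S' H : 'rV[R]_(1 + n)) : x + (S + H) - (x + S' + H) = S - S'.
  by apply/rowP => i0; rewrite !mxE; ring.
set z' := z + row_mx s'%:M 0 in Ds'.
have D1 := Ds' h (le_lt_trans hk ki).
have D2 := Da1 s%:M.
rewrite e'E in D1; rewrite e1E norm_scalar_mx1 in D2.
have {}D2 := D2 (le_lt_trans sk k1).
have lip1 : `|f (z + k) - f (z' + row_mx 0 h)| <= L * (c * `|s|).
  apply: le_trans (f_lip _ _) _; rewrite ler_wpM2l//.
  have -> : z + k - (z' + row_mx 0 h) = row_mx (s - s')%:M 0.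
    by rewrite rowB /z' [X in z + X - _]kE kE2 zK.
  by rewrite norm_row_mx_l norm_scalar_mx1 distrC.
have lip2 : `|f z' - f (z + row_mx s%:M 0)| <= L * (c * `|s|).
  apply: le_trans (f_lip _ _) _; rewrite ler_wpM2l//.
  have -> : z' - (z + row_mx s%:M 0) = row_mx (s' - s)%:M 0.
    by rewrite rowB /z' opprD addrACA subrr add0r.
  by rewrite norm_row_mx_l norm_scalar_mx1.
set A1 := f (z + k) - _ in lip1.
set A2 := f z' - _ in lip2.
set A3 := _ - _ - _ in D1; set A4 := _ - _ - _ in D2.
have -> : f (z + k) - f z - ((s%:M *m a1) 0 0 + (h *m map_mx ratr a') 0 0) =
  A1 + A3 + A2 + A4 by rewrite /A1 /A2 /A3 /A4; ring.
apply: le_trans (ler_normD _ _) _.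
apply: le_trans (lerD (ler_normD _ _) (lexx _)) _.
apply: le_trans (lerD (lerD (ler_normD _ _) (lexx _)) (lexx _)) _.
have ck : c * `|h| <= c * `|k| by rewrite ler_wpM2l// ltW.
have cs : L * (c * `|s|) <= L * (c * `|k|).
  by rewrite ler_wpM2l// ler_wpM2l// ltW.
have es : eps / 2 * `|s| <= eps / 2 * `|k| by rewrite ler_wpM2l//; lra.
have cEk : ((2 * L + 1) * c) * `|k| <= eps / 2 * `|k| by rewrite ler_wpM2r.
rewrite -/c in D1.
have ckE : ((2 * L + 1) * c) * `|k| = 2 * (L * (c * `|k|)) + c * `|k| by ring.
lra.
Qed.

(** Each [h] imposes a closed condition on [z], and closedness survives the intersection over
    uncountably many [h]. *)
Lemma closed_slope_set (R : realType) (k n : nat) (f : 'rV[R]_n -> R)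
    (E : 'M[R]_(k, n)) (eps dl : R) (a : 'cV[R]_k) :
  continuous f -> closed (slope_set f E eps dl a).
Proof.
move=> cf.
rewrite (_ : slope_set _ _ _ _ _ = \bigcap_(h in [set h : 'rV[R]_k | `|h| < dl])
    ((fun z => `|f (z + h *m E) - f z - (h *m a) 0 0|) @^-1` [set t | t <= eps * `|h|])).
  apply: closed_bigI => h _.
  have /continuous_closedP : continuous (fun z : 'rV[R]_n => `|f (z + h *m E) - f z - (h *m a) 0 0|).
    move=> z.
    have shift : z' + h *m E @[z' --> z] --> z + h *m E.
      exact: (cvgD (@cvg_id _ _) (@cvg_cst _ _ _ _ _)).
    have fshift : f (z' + h *m E) @[z' --> z] --> f (z + h *m E).
      exact: (cvg_comp _ _ shift (cf _)).
    have fc : (f (z' + h *m E) - f z' - (h *m a) 0 0) @[z' --> z] -->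
       f (z + h *m E) - f z - (h *m a) 0 0.
      exact: (cvgB (cvgB fshift (cf z)) (@cvg_cst _ _ _ _ _)).
    exact: cvg_norm fc.
  by apply; exact: closed_le.
by [].
Qed.

Lemma measurable_quasi_diff (R : realType) (dsp : measure_display)
    (T : measurableType dsp) (k n : nat) (phi : T -> 'rV[R]_n)
    (f : 'rV[R]_n -> R) (E : 'M[R]_(k, n)) :
  (forall U, open U -> measurable (phi @^-1` U)) -> continuous f ->
  measurable [set x | ~ quasi_diff f E (phi x)].
Proof.
move=> mphi cf.
have mclosed C : closed C -> measurable (phi @^-1` C).
  move=> cC; rewrite -[C]setCK preimage_setC; apply: measurableC.
  exact: (mphi _ (closed_openC cC)).
apply: measurableC.
rewrite (_ : (fun x => _) = \bigcap_(j in [set: nat]) \bigcup_(i in [set: nat])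
   \bigcup_(a in [set: 'cV[rat]_k])
     (phi @^-1` (slope_set f E j.+1%:R^-1 i.+1%:R^-1 (map_mx ratr a)))).
  apply: bigcap_measurable => // j _; apply: bigcup_measurable => i _.
  apply: countable_bigcupT_measurable => // a.
  exact: (mclosed _ (closed_slope_set cf)).
apply/seteqP; split => x /=.
  by move=> /quasi_diff_countable qd j _; have [i [a Da]] := qd j; exists i => //; exists a.
by move=> qd; apply/quasi_diff_countable => j; have [i _ [a _ Da]] := qd j I; exists i, a.
Qed.

(** The tube lemma for the compact segment [[a, b]]. Openness is what allows the union over
    uncountably many [s] in [measurable_porous]. *)
Lemma open_gap (R : realType) (n : nat) (D : set 'rV[R]_n) (v : 'rV[R]_n) (a b : R) :
  closed D -> open [set z | forall t, a <= t <= b -> ~ D (z + t *: v)].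
Proof.
move=> cD; rewrite openE => z zD.
have cov : forall t, `[a, b]%classic t ->
    \forall t' \near t & y \near nbhs z, ~ D (y + t' *: v).
  move=> t; rewrite /= in_itv/= => tab.
  have cont : (fun p : R * 'rV[R]_n => p.2 + p.1 *: v) @
      filter_prod (nbhs t) (nbhs z) --> z + t *: v.
    apply: (@cvgD _ _ _ _ _ snd (fun p : R * 'rV[R]_n => p.1 *: v)).
      exact: cvg_snd.
    apply: (@cvgZr_tmp _ _ _ _ _ fst); exact: cvg_fst.
  apply: (cont (~` D)).
  by apply: open_nbhs_nbhs; split; [exact: closed_openC|exact: zD].
have /compact_near_coveringP /(_ _ (nbhs z) (fun y t => ~ D (y + t *: v))) :=
  @segment_compact R a b.
move=> /(_ _ cov); apply: filterS => y yD t tab; apply: yD; by rewrite /= in_itv.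
Qed.

(** * Almost everywhere differentiability in R^n *)

Lemma product_null_xsection (R : realType) (d1 d2 : measure_display)
    (T1 : measurableType d1) (T2 : measurableType d2)
    (m1 : {measure set T1 -> \bar R}) (m2 : {sigma_finite_measure set T2 -> \bar R})
    (A : set (T1 * T2)) :
  (forall x, m2 (xsection A x) = 0) -> (m1 \x m2)%E A = 0.
Proof.
by move=> A0; rewrite /product_measure1 integral0_eq// => x _ /=; exact: A0.
Qed.

(** [\x] integrates the [xsection]s by definition; uniqueness of the product measure exchanges it
    for [\x^], which integrates the [ysection]s. *)
Lemma product_null_ysection (R : realType) (d1 d2 : measure_display)
    (T1 : measurableType d1) (T2 : measurableType d2)
    (m1 : {sigma_finite_measure set T1 -> \bar R})
    (m2 : {sigma_finite_measure set T2 -> \bar R}) (A : set (T1 * T2)) :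
  measurable A -> (forall y, m1 (ysection A y) = 0) -> (m1 \x m2)%E A = 0.
Proof.
move=> mA A0.
rewrite (@product_measure_unique _ _ _ _ _ m1 m2 (m1 \x^ m2)%E)//.
  by rewrite /= /product_measure2 integral0_eq// => y _ /=; exact: A0.
by move=> B C mB mC; exact: product_measure2E.
Qed.

Lemma open_norm_ball (R : realType) (V : normedModType R) (c : V) (e : R) :
  open [set y | `|y - c| < e].
Proof.
have /continuousP/(_ [set r | r < e]) : continuous (fun y : V => `|y - c|).
  by move=> y; apply: cvg_norm; exact: (cvgB (@cvg_id _ _) (@cvg_cst _ _ _ _ _)).
by apply; exact: open_lt.
Qed.

Lemma open_row_mx_box (R : realType) (n : nat) (U : set 'rV[R]_(1 + n)) (t : R)
    (y : 'rV[R]_n) :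
  open U -> U (row_mx t%:M y) ->
  exists (q : rat) (p : 'rV[rat]_n) (e : rat),
    [/\ `|t - ratr q| < ratr e, `|y - map_mx ratr p| < ratr e &
     forall t' y', `|t' - ratr q| < ratr e -> `|y' - map_mx ratr p| < ratr e ->
       U (row_mx t'%:M y')].
Proof.
move=> oU Uty.
have /nbhs_normP[dl /= dl0 dlU] : nbhs (row_mx t%:M y) U by exact: open_nbhs_nbhs.
have [e] := @rat_in_itvoo R 0 (dl / 2) ltac:(by rewrite divr_gt0).
rewrite in_itv/= => /andP[e0 edl].
have [p pE] := rat_mx_dense y e0.
have [q'] := rat_mx_dense (t%:M : 'M[R]_1) e0.
rewrite (_ : map_mx _ _ = (ratr (q' 0 0))%:M); last by rewrite [LHS]mx11_scalar mxE.
rewrite -raddfB/= norm_scalar_mx1 => qE.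
exists (q' 0 0), p, e; split; [by rewrite distrC|by rewrite distrC|].
move=> t' y' t'q y'p; apply: dlU => /=.
rewrite opp_row_mx add_row_mx -raddfB/=.
apply: (@le_lt_trans _ _ (2 * ratr e)); last by lra.
have twoe : 0 <= 2 * ratr e :> R by rewrite mulr_ge0// ltW.
have -> : t - t' = (t - ratr (q' 0 0)) - (t' - ratr (q' 0 0)) by ring.
have -> : y - y' = (y - map_mx ratr p) - (y' - map_mx ratr p).
  by rewrite opprB addrA subrK.
have two (V : normedModType R) (a b : V) : `|a| < ratr e -> `|b| < ratr e ->
    `|a - b| <= 2 * ratr e.
  by move=> ae be; apply: le_trans (ler_normB _ _) _; lra.
apply: mx_norm_le => // i j; rewrite mxE; case: splitP => k _.
  by rewrite !ord1 mxE eqxx mulr1n two// distrC.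
by apply: le_trans (mx_entry_le_norm _ _ _) _; rewrite two// distrC.
Qed.

(** An open set is a countable union of boxes with rational data, and the preimage of a box is a
    measurable rectangle. *)
Lemma measurable_row_mx_preimage (R : realType) (n : nat) (dsp : measure_display)
    (T : measurableType dsp) (phi : T -> 'rV[R]_n) :
  (forall U, open U -> measurable (phi @^-1` U)) ->
  forall U, open U ->
  measurable ((fun p : measurableTypeR R * T => row_mx p.1%:M (phi p.2)) @^-1` U).
Proof.
move=> mphi U oU.
pose box (i : rat * 'rV[rat]_n * rat) : set (measurableTypeR R * T) :=
  [set t : R | `|t - ratr i.1.1| < ratr i.2] `*`
  (phi @^-1` [set y | `|y - map_mx ratr i.1.2| < ratr i.2]).
pose inU (i : rat * 'rV[rat]_n * rat) := forall (t' : R) y',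
  `|t' - ratr i.1.1| < ratr i.2 -> `|y' - map_mx ratr i.1.2| < ratr i.2 ->
       U (row_mx t'%:M y').
(* Boxes not contained in [U] are replaced by the empty set, so that the union runs over a whole
   countable type. *)
rewrite (_ : _ @^-1` _ = \bigcup_i (if `[< inU i >] then box i else set0)).
  apply: countable_bigcupT_measurable => // i; case: ifPn => // _.
  apply: measurableX; last by apply: mphi; exact: open_norm_ball.
  by apply: open_measurable; exact: open_norm_ball.
apply/seteqP; split => [[t x] /= Utx|[t x] [i _]].
  have [q [p [e [tq yp inUi]]]] := open_row_mx_box oU Utx.
  by exists (q, p, e) => //; rewrite ifT//; exact/asboolP.
by case: ifPn => // /asboolP iU [/= ti xi]; exact: iU.
Qed.

Lemma derivable_quasi_diff (R : realType) (n : nat) (f : 'rV[R]_(1 + n) -> R)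
    (t : R) (y : 'rV[R]_n) :
  derivable (fun u => f (row_mx u%:M y)) t 1 ->
  quasi_diff f (row_mx 1%:M 0 : 'M[R]_(1, 1 + n)) (row_mx t%:M y).
Proof.
set g := fun u => _; move=> /cvg_ex[/= l gl] eps eps0.
have /cvgrPdist_le/(_ _ eps0)[dl /= dl0 dlE] := gl.
exists dl => //; exists (l%:M) => h hdl.
rewrite mul_mx_row mulmx1 mulmx0 add_row_mx addr0.
have hE : h = (h 0 0)%:M by rewrite [LHS]mx11_scalar.
set s := h 0 0 in hE; rewrite hE norm_scalar_mx1 in hdl *.
rewrite -raddfD/= -scalar_mxM mxE eqxx mulr1n.
rewrite -/(g (t + s)) -/(g t).
have [->|s0] := eqVneq s 0; first by rewrite addr0 subrr mul0r subr0 normr0 mulr0.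
have := dlE s; rewrite /= sub0r normrN => /(_ hdl s0).
rewrite {1}/GRing.scale/= {1}/GRing.scale/= mulr1 (addrC s) => le_eps.
have -> : g (t + s) - g t - s * l = - (s * (l - s^-1 * (g (t + s) - g t))).
  by field.
by rewrite normrN normrM mulrC ler_wpM2r.
Qed.

Lemma quasi_diff_row_mx (R : realType) (n : nat) (f : 'rV[R]_(1 + n) -> R)
    (t : R) (y : 'rV[R]_n) :
  quasi_diff f (row_mx 0 1%:M : 'M[R]_(n, 1 + n)) (row_mx t%:M y) <->
  quasi_diff (fun y' => f (row_mx t%:M y')) 1%:M y.
Proof.
have key (h : 'rV[R]_n) : row_mx t%:M y + h *m (row_mx 0 1%:M : 'M[R]_(n, 1 + n)) =
    row_mx t%:M (y + h *m 1%:M).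
  by rewrite mul_mx_row mulmx1 mulmx0 add_row_mx addr0.
by split=> qd eps eps0; have [dl dl0 [a Da]] := qd eps eps0; exists dl => //;
  exists a => h hdl; have := Da h hdl; rewrite key.
Qed.

(** The index [k] is countable but [s] is real; for each [k] the union over [s] is open because
    every [gap s] is, and only the intersection over [k] relies on countability. *)
Lemma measurable_porous (R : realType) (n : nat) (dsp : measure_display)
    (T : measurableType dsp) (phi : T -> 'rV[R]_n) (D : set 'rV[R]_n)
    (v : 'rV[R]_n) (c : R) :
  (forall U, open U -> measurable (phi @^-1` U)) -> closed D ->
  measurable [set x | D (phi x) /\ forall k : nat, exists s : R,
    0 < `|s| < k.+1%:R^-1 /\
    forall s', `|s' - s| <= c * `|s| -> ~ D (phi x + s' *: v)].
Proof.
move=> mphi cD.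
pose gap (s : R) := [set z | forall s', s - c * `|s| <= s' <= s + c * `|s| ->
  ~ D (z + s' *: v)].
rewrite (_ : [set _ | _] = ~` (phi @^-1` (~` D)) `&` \bigcap_(k in [set: nat])
  (phi @^-1` (\bigcup_(s in [set s : R | 0 < `|s| < k.+1%:R^-1]) gap s))).
  apply: measurableI.
    by apply: measurableC; apply: mphi; exact: closed_openC.
  apply: bigcap_measurable => // k _; apply: mphi.
  by apply: bigcup_open => s _; exact: open_gap.
apply/seteqP; split => x /=.
  move=> [Dx gapx]; split; first by move=> /(_ Dx).
  move=> k _; have [s [sk gaps]] := gapx k; exists s => // s' /andP[s1 s2].
  by apply: gaps; rewrite ler_norml; apply/andP; split; lra.
move=> [Dx gapx]; split; first exact: contrapT.
move=> k; have [s sk gaps] := gapx k I; exists s; split => // s'.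
by rewrite ler_norml => /andP[s1 s2]; apply: gaps; apply/andP; split; lra.
Qed.

(** The exceptional set is covered by three kinds of null sets: failure along the new line and
    porosity of some [D j i a], both null on each line, and failure in the old coordinates, null on
    each slice of constant [t] by induction. *)
Lemma rademacher_step (R : realType) (n : nat) (dsp : measure_display)
    (T : measurableType dsp) (mu : {sigma_finite_measure set T -> \bar R})
    (phi : T -> 'rV[R]_n) :
  let phi' := fun p : measurableTypeR R * T => row_mx p.1%:M (phi p.2) in
  (forall U, open U -> measurable (phi @^-1` U)) ->
  (forall (f : 'rV[R]_n -> R) (L : R), 0 <= L ->
     (forall x y, `|f x - f y| <= L * `|x - y|) ->
     mu [set x | ~ quasi_diff f 1%:M (phi x)] = 0%E) ->
  forall (f : 'rV[R]_(1 + n) -> R) (L : R), 0 <= L ->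
     (forall x y, `|f x - f y| <= L * `|x - y|) ->
     (@lebesgue_measure R \x mu)%E [set p | ~ quasi_diff f 1%:M (phi' p)] = 0%E.
Proof.
move=> phi' mphi IH f L L0 f_lip.
have mphi' : forall U, open U -> measurable (phi' @^-1` U).
  exact: measurable_row_mx_preimage.
have cf : continuous f := lipschitz_continuous f_lip.
pose E1 : 'M[R]_(1, 1 + n) := row_mx 1%:M 0.
pose E' : 'M[R]_(n, 1 + n) := row_mx 0 1%:M.
pose D (j i : nat) (a : 'cV[rat]_n) :=
  slope_set f E' j.+1%:R^-1 i.+1%:R^-1 (map_mx ratr a).
have cD j i a : closed (D j i a) by exact: closed_slope_set.
have shift t s y : row_mx t%:M y + s *: row_mx 1%:M 0 = row_mx (t + s)%:M y :> 'rV[R]_(1 + n).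
  by rewrite scale_row_mx scaler0 scale_scalar_mx mulr1 add_row_mx addr0 -raddfD.
(* Points of [D j i a] where this set has gaps of relative size [1 / (j + 1)] along the new line at
   arbitrarily small distances. Rational slopes leave countably many such sets. *)
pose P (j i : nat) (a : 'cV[rat]_n) := [set x | D j i a (phi' x) /\ forall k : nat, exists s : R,
    0 < `|s| < k.+1%:R^-1 /\
    forall s', `|s' - s| <= j.+1%:R^-1 * `|s| -> ~ D j i a (phi' x + s' *: row_mx 1%:M 0)].
have mP j i a : measurable (P j i a) by exact: measurable_porous.
have P0 j i a : (@lebesgue_measure R \x mu)%E (P j i a) = 0%E.
  apply: product_null_ysection => // y.
  have mA : measurable (ysection (phi' @^-1` D j i a) y).
    apply: measurable_ysection.
    rewrite -[D j i a]setCK preimage_setC; apply: measurableC.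
    exact: (mphi' _ (closed_openC (cD j i a))).
  have c0 : 0 < j.+1%:R^-1 :> R by rewrite invr_gt0.
  have np := ae_not_porous mA c0.
  apply: measure_negligible; first exact: measurable_ysection.
  apply: negligibleS np => t; rewrite /ysection/= inE => -[Dt gap] np.
  have := np; rewrite inE => /(_ Dt)[dl dl0 dlE].
  have [k kdl] := inv_natS_lt dl0.
  have [s [/andP[s0 sk] gaps]] := gap k.
  have [|s' s's] := dlE s; first by rewrite s0 (lt_trans sk kdl).
  by rewrite inE/=; move: (gaps s' s's); rewrite /phi'/= shift.
have N10 : (@lebesgue_measure R \x mu)%E [set p | ~ quasi_diff f E1 (phi' p)] = 0%E.
  have mN : measurable [set p | ~ quasi_diff f E1 (phi' p)].
    exact: measurable_quasi_diff.
  apply: product_null_ysection => // y.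
  apply: measure_negligible; first exact: measurable_ysection.
  have h_lip t t' : `|f (row_mx t%:M (phi y)) - f (row_mx t'%:M (phi y))| <= L * `|t - t'|.
    apply: le_trans (f_lip _ _) _.
    by rewrite opp_row_mx add_row_mx subrr -raddfB norm_row_mx_l norm_scalar_mx1.
  have := lipschitz_ae_derivable h_lip.
  apply: negligibleS => t; rewrite /ysection/= inE/= => nqd dt; apply: nqd.
  exact: derivable_quasi_diff.
have N'0 : (@lebesgue_measure R \x mu)%E [set p | ~ quasi_diff f E' (phi' p)] = 0%E.
  apply: product_null_xsection => t.
  have ft_lip x y : `|f (row_mx t%:M x) - f (row_mx t%:M y)| <= L * `|x - y|.
    apply: le_trans (f_lip _ _) _.
    by rewrite opp_row_mx add_row_mx subrr norm_row_mx_r.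
  rewrite -[RHS](IH _ _ L0 ft_lip); congr (mu _).
  apply/seteqP; split => x; rewrite /xsection/= inE/=; apply: contra_not => qd.
    exact: (quasi_diff_row_mx f t (phi x)).2 qd.
  exact: (quasi_diff_row_mx f t (phi x)).1 qd.
apply: measure_negligible; first exact: measurable_quasi_diff.
pose PP (k : nat) := if unpickle k is Some (j, i, a) then P j i a else set0.
have negPP k : (@lebesgue_measure R \x mu)%E.-negligible (PP k).
  rewrite /PP; case: unpickle => [[[j i] a]|]; last exact: negligible_set0.
  by apply/negligibleP; [exact: mP|exact: P0].
have neg1 : (@lebesgue_measure R \x mu)%E.-negligible [set p | ~ quasi_diff f E1 (phi' p)].
  by apply/negligibleP => //; exact: measurable_quasi_diff.
have neg' : (@lebesgue_measure R \x mu)%E.-negligible [set p | ~ quasi_diff f E' (phi' p)].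
  by apply/negligibleP => //; exact: measurable_quasi_diff.
apply: negligibleS (negligibleU (negligibleU neg1 neg') (negligible_bigcup negPP)).
move=> p /= nqd; apply: contrapT => /not_orP[/not_orP[/contrapT q1 /contrapT q'] nP].
apply: nqd; apply: (@quasi_diff_step _ _ _ L) => // j i a D0 Da.
apply: contrapT => noP; apply: nP.
exists (pickle (j, i, a)) => //; rewrite /PP pickleK; split => // k.
apply: contrapT => nos; apply: noP; exists k.+1%:R^-1; first by rewrite invr_gt0.
move=> s sk; apply: contrapT => nos'; apply: nos; exists s; split => // s' s's Ds'.
apply: nos'; exists s' => //; move: Ds'.
by rewrite scale_row_mx scaler0 scale_scalar_mx mulr1.
Qed.

Lemma sigma_finite_product (R : realType) (d1 d2 : measure_display)
    (T1 : measurableType d1) (T2 : measurableType d2)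
    (m1 : {sigma_finite_measure set T1 -> \bar R})
    (m2 : {sigma_finite_measure set T2 -> \bar R}) :
  sigma_finite setT (m1 \x m2)%E.
Proof.
have [F FT Ffin] := sigma_finiteT m1; have [G GT Gfin] := sigma_finiteT m2.
pose H (k : nat) := if unpickle k is Some (i, j) then F i `*` G j else set0.
exists H.
  apply/esym; rewrite -subTset => -[x y] _.
  have [i _ Fx] : (\bigcup_i F i) x by rewrite -FT.
  have [j _ Gy] : (\bigcup_i G i) y by rewrite -GT.
  by exists (pickle (i, j)) => //; rewrite /H pickleK.
move=> k; rewrite /H; case: unpickle => [[i j]|]; last by rewrite measure0 ltry.
have [mF Fi] := Ffin i; have [mG Gj] := Gfin j.
split; first exact: measurableX.
by rewrite product_measure1E// lte_mul_pinfty// ge0_fin_numE.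
Qed.

(* The measure lives on an abstract iterated product T of lines and is only
   seen through phi, since 'rV_n carries no measure of its own. *)
Lemma rademacher_model (R : realType) (n : nat) :
  exists (dsp : measure_display) (T : measurableType dsp)
    (mu : {sigma_finite_measure set T -> \bar R}) (phi : T -> 'rV[R]_n),
  [/\ forall U, open U -> measurable (phi @^-1` U),
      forall U, open U -> U !=set0 -> (0 < mu (phi @^-1` U))%E &
      forall (f : 'rV[R]_n -> R) (L : R), 0 <= L ->
        (forall x y, `|f x - f y| <= L * `|x - y|) ->
        mu [set x | ~ quasi_diff f 1%:M (phi x)] = 0%E].
Proof.
elim: n => [|n [dsp [T [mu [phi [mphi posphi radphi]]]]]].
  (* In dimension 0 the model is one point of unit mass. *)
  exists _, unit, (@dirac _ unit tt R), (fun _ => 0); split => //.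
    move=> U oU [x Ux]; rewrite /= /dirac indicE mem_set ?lte_fin//=.
    by rewrite (_ : 0 = x)//; apply/rowP => -[].
  move=> f L L0 f_lip; rewrite (_ : [set _ | _] = set0) ?measure0//.
  rewrite -subset0 => x /=; apply => eps eps0; exists 1 => //; exists 0 => h _.
  have -> : h = 0 by apply/rowP => -[].
  by rewrite !mul0mx addr0 subrr sub0r mxE oppr0 !normr0 mulr0.
have mphi' := measurable_row_mx_preimage mphi.
pose pm := HB.pack_for
  {sigma_finite_measure set (measurableTypeR R * T)%type -> \bar R}
  (@lebesgue_measure R \x mu)%E
  (Measure_isSigmaFinite.Build _ _ _ (@lebesgue_measure R \x mu)%E
     (sigma_finite_product _ _)).
exists _, _, pm, (fun p => row_mx p.1%:M (phi p.2)); split => //.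
- move=> U oU [z Uz].
  have zE : z = row_mx (lsubmx (z : 'rV[R]_(1 + n)) 0 0)%:M (rsubmx (z : 'rV[R]_(1 + n))).
    by rewrite -[LHS](@hsubmxK _ _ 1 n) [X in row_mx X _]mx11_scalar.
  rewrite zE in Uz.
  (* The preimage of [U] contains a rectangle [I] times [phi @^-1] of [V], whose measure is a
     product of two positive factors. *)
  have [q [p [e [tq yp boxU]]]] := @open_row_mx_box R n U _ _ oU Uz.
  pose I : set (measurableTypeR R) := `](ratr q - ratr e), (ratr q + ratr e)[%classic.
  pose V := [set y : 'rV[R]_n | `|y - map_mx ratr p| < ratr e].
  have e0 : 0 < ratr e :> R by apply: le_lt_trans tq.
  have V0 : (0 < mu (phi @^-1` V))%E.
    by apply: posphi; [exact: open_norm_ball|exists (rsubmx (z : 'rV[R]_(1 + n)))].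
  have mV : measurable (phi @^-1` V) by apply: mphi; exact: open_norm_ball.
  have mI : measurable I by exact: measurable_itv.
  have I0 : (0 < @lebesgue_measure R I)%E.
    rewrite /I lebesgue_measure_itv/= lte_fin ifT; last lra.
    by rewrite -EFinB lte_fin; lra.
  apply: (@lt_le_trans _ _ ((@lebesgue_measure R \x mu)%E (I `*` (phi @^-1` V)))).
    by rewrite product_measure1E// mule_gt0.
  apply: le_measure; rewrite ?inE.
  + exact: measurableX.
  + exact: mphi'.
  + move=> [t x] [/= It Vx]; apply: boxU => //.
    move: It; rewrite /I/= in_itv/= => /andP[t1 t2].
    by rewrite ltr_norml; apply/andP; split; lra.
- exact: rademacher_step.
Qed.

(** * The mean value inequality *)

(** Slopes for the errors [r i] and [r j] are compared on a small multiple of a basis vector, where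
    both approximations hold: their entries differ by at most [r i + r j], so the slopes
    converge. *)
Lemma quasi_diff_slope (R : realType) (n : nat) (f : 'rV[R]_n -> R) (x : 'rV[R]_n) :
  quasi_diff f 1%:M x ->
  exists l : 'cV[R]_n, forall eps, 0 < eps -> exists2 dl, 0 < dl &
    forall h, `|h| < dl -> `|f (x + h) - f x - (h *m l) 0 0| <= eps * `|h|.
Proof.
move=> qd.
have [r rE] : exists r : nat -> R, forall j, r j = j.+1%:R^-1.
  by exists (fun j => j.+1%:R^-1).
have /choice[da daE] : forall j : nat, exists da : R * 'cV[R]_n, 0 < da.1 /\
    slope_set f 1%:M (r j) da.1 da.2 x.
  move=> j; have j0 : 0 < r j by rewrite rE invr_gt0.
  by have [dl dl0 [a Da]] := qd _ j0; exists (dl, a).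
pose a j := (da j).2.
have a_cauchy i j k : `|a i k 0 - a j k 0| <= r i + r j.
  have [di0 Di] := daE i; have [dj0 Dj] := daE j.
  pose s := Num.min (da i).1 (da j).1 / 2.
  have s0 : 0 < s by rewrite divr_gt0// lt_min di0 dj0.
  have sm : s < Num.min (da i).1 (da j).1 by rewrite ltr_pdivrMr// ltr_pMr ?ltr1n// lt_min di0 dj0.
  pose h : 'rV[R]_n := s *: delta_mx 0 k.
  have hs : `|h| = s.
    rewrite normrZ gtr0_norm//; suff -> : `|delta_mx 0 k : 'rV[R]_n| = 1 by rewrite mulr1.
    apply/eqP; rewrite eq_le; apply/andP; split.
      by apply: mx_norm_le => // i0 j0; rewrite mxE; case: (_ && _); rewrite ?normr1 ?normr0.
    by apply: le_trans (mx_entry_le_norm _ 0 k); rewrite mxE !eqxx normr1.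
  have ha (b : 'cV[R]_n) : (h *m b) 0 0 = s * b k 0.
    by rewrite -scalemxAl mxE -rowE mxE.
  move: sm; rewrite lt_min => /andP[si sj].
  have := Di h; rewrite hs => /(_ si); have := Dj h; rewrite hs => /(_ sj).
  rewrite !ha -/(a i) -/(a j); set u := f _ - f _ => uj ui.
  rewrite -(ler_pM2l s0) -{1}(gtr0_norm s0) -normrM.
  have -> : s * (a i k 0 - a j k 0) = (u - s * a j k 0) - (u - s * a i k 0) by ring.
  apply: le_trans (ler_normB _ _) _.
  by rewrite mulrDr addrC ![s * r _]mulrC lerD.
(* The limit of the Cauchy sequence, as the supremum of the lower bounds [a j k 0 - r j]; every
   [a i k 0 + r i] is an upper bound. *)
pose l : 'cV[R]_n := \col_k sup (range (fun j => a j k 0 - r j)).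
have lE j k : `|l k 0 - a j k 0| <= r j.
  have ub i : ubound (range (fun j => a j k 0 - r j)) (a i k 0 + r i).
    by move=> _ [i' _ <-]; have := a_cauchy i' i k; rewrite ler_norml => /andP[_] /=; lra.
  have ne : (range (fun j => a j k 0 - r j)) !=set0.
    by exists (a j k 0 - r j); exists j.
  rewrite /l mxE ler_norml; apply/andP; split.
    have : a j k 0 - r j <= sup (range (fun j => a j k 0 - r j)).
      apply: ub_le_sup; last by exists j.
      by exists (a j k 0 + r j); exact: ub.
    by lra.
  have : sup (range (fun j => a j k 0 - r j)) <= a j k 0 + r j.
    by apply: ge_sup => //; exact: ub.
  by lra.
exists l => eps eps0.
(* One share of the error is for the approximation with slope [a j], and [n] shares are for
   replacing [a j] by [l] in a sum of [n] terms. *)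
have n0 : 0 < n.+1%:R :> R by [].
have [j jeps] := inv_natS_lt (divr_gt0 eps0 n0).
have [dj0 Dj] := daE j; exists (da j).1 => // h hd.
have := Dj h hd; rewrite mulmx1 -/(a j) => Dh.
have subE (M N : 'M[R]_1) : (M - N) 0 0 = M 0 0 - N 0 0 by rewrite !mxE.
have -> : f (x + h) - f x - (h *m l) 0 0 = (f (x + h) - f x - (h *m a j) 0 0) -
    (h *m (l - a j)) 0 0 by rewrite mulmxBr subE; ring.
apply: le_trans (ler_normB _ _) _.
have h1 : `|(h *m (l - a j)) 0 0| <= n%:R * r j * `|h|.
  apply: le_trans (mx_entry_le_norm _ _ _) _; apply: le_trans (mulmx_norm_le _ _) _.
  rewrite -!mulrA ler_wpM2l// mulrC ler_wpM2r//.
  apply: mx_norm_le => [|k i]; first by rewrite rE invr_ge0.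
  have subEc (M N : 'cV[R]_n) : (M - N) k 0 = M k 0 - N k 0 by rewrite !mxE.
  by rewrite !ord1 subEc.
apply: le_trans (lerD Dh h1) _; rewrite -mulrDl ler_wpM2r//.
move: jeps; rewrite -rE; rewrite ltr_pdivlMr// => /ltW; apply: le_trans.
by rewrite -natr1 mulrDr mulr1 addrC lerD2r mulrC.
Qed.

Lemma slope_is_diff (R : realType) (n p : nat) (F : 'rV[R]_n -> 'rV[R]_p)
    (x : 'rV[R]_n) (A : 'M[R]_(n, p)) :
  (forall eps, 0 < eps -> exists2 dl, 0 < dl &
    forall h, `|h| < dl -> `|F (x + h) - F x - h *m A| <= eps * `|h|) ->
  differentiable F x.
Proof.
move=> FA.
pose df : {linear 'rV[R]_n -> 'rV[R]_p} := mulmxr A.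
have cA : continuous df.
  apply: (@lipschitz_continuous _ _ _ _ (n%:R * `|A|)) => y z /=.
  by rewrite -mulmxBl; apply: le_trans (mulmx_norm_le _ _) _; rewrite mulrAC.
have near_le eps : 0 < eps -> \forall h \near (0 : 'rV[R]_n),
    `|F (h + x) - (F x + h *m A)| <= eps * `|h|.
  move=> eps0; have [dl dl0 dlE] := FA eps eps0.
  apply/nbhs_normP; exists dl => //= h; rewrite /= sub0r normrN => hdl.
  by have := dlE h hdl; rewrite (addrC h) opprD addrA.
have dFE : 'd F x = df :> (_ -> _).
  by apply: diff_unique => //; apply/eqaddoP => eps eps0; exact: near_le.
apply/diff_locallyP; rewrite dFE; split => //.
by apply/eqaddoP => eps eps0; exact: near_le.
Qed.

Lemma quasi_diff_differentiable (R : realType) (n p : nat) (F : 'rV[R]_n -> 'rV[R]_p)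
    (x : 'rV[R]_n) :
  (forall i, quasi_diff (fun y => F y 0 i) 1%:M x) -> differentiable F x.
Proof.
move=> qd.
have /choice[l lE] := fun i => quasi_diff_slope (qd i).
apply: (@slope_is_diff _ _ _ _ _ (\matrix_(k, i) l i k 0)) => eps eps0.
have /choice[dl dlE] : forall i, exists dl : R, 0 < dl /\ forall h, `|h| < dl ->
    `|F (x + h) 0 i - F x 0 i - (h *m l i) 0 0| <= eps * `|h|.
  by move=> i; have [dl dl0 ?] := lE i eps eps0; exists dl.
exists (\big[Num.min/1]_i dl i).
  by rewrite lt_bigmin//= => i _; have [] := dlE i.
move=> h hdl; apply: mx_norm_le => [|i0 i]; first by rewrite mulr_ge0// ltW.
have [dl0 dli] := dlE i; rewrite !ord1 => {i0}.
have hi : `|h| < dl i by apply: lt_le_trans hdl _; exact: bigmin_le_cond.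
have := dli h hi; congr (`|_| <= _).
rewrite !mxE; congr (_ - _).
by apply: eq_bigr => k _; rewrite !mxE.
Qed.

(** McShane's formula, the infimum of the cones [f a + L * |x - a|]. It bridges Rademacher's theorem
    for functions Lipschitz on the whole space and a map that is Lipschitz only on a ball. *)
Lemma lipschitz_extension (R : realType) (V : normedModType R) (A : set V)
    (f : V -> R) (L : R) :
  0 <= L -> (forall x y, A x -> A y -> `|f x - f y| <= L * `|x - y|) ->
  exists2 g : V -> R, (forall x y, `|g x - g y| <= L * `|x - y|) &
    forall x, A x -> g x = f x.
Proof.
move=> L0 f_lip; have [[a0 Aa0]|A0] := pselect (exists a, A a); last first.
  by exists (fun _ => 0) => [x y|x Ax]; [rewrite subrr normr0 mulr_ge0|case: A0; exists x].
pose S x := [set f a + L * `|x - a| | a in A].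
have Sne x : (S x) !=set0 by exists (f a0 + L * `|x - a0|); exists a0.
have Slb x : has_lbound (S x).
  exists (f a0 - L * `|a0 - x|) => _ [a Aa <-].
  have := le_trans (ler_norm _) (f_lip _ _ Aa0 Aa).
  have := ler_wpM2l L0 (ler_distD x a0 a); rewrite mulrDr.
  by lra.
have infle x y : inf (S x) <= inf (S y) + L * `|x - y|.
  rewrite -lerBlDr; apply: lb_le_inf => // _ [a Aa <-].
  rewrite lerBlDr; apply: (@le_trans _ _ (f a + L * `|x - a|)).
    by apply: ge_inf => //; exists a.
  have := ler_wpM2l L0 (ler_distD y x a); rewrite mulrDr.
  by lra.
exists (fun x => inf (S x)) => [x y|x Ax].
  rewrite ler_norml; apply/andP; split.
    by have := infle y x; rewrite (distrC y); lra.
  by have := infle x y; lra.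
apply/eqP; rewrite eq_le; apply/andP; split.
  by apply: ge_inf => //; exists x => //; rewrite subrr normr0 mulr0 addr0.
apply: lb_le_inf => // _ [a Aa <-].
by have := le_trans (ler_norm _) (f_lip _ _ Ax Aa); lra.
Qed.

Lemma quasi_diff_shift (R : realType) (n : nat) (f : 'rV[R]_n -> R) (y c : 'rV[R]_n) :
  quasi_diff f 1%:M (y + c) <-> quasi_diff (fun x => f (x + c)) 1%:M y.
Proof.
have key (h : 'rV[R]_n) : y + c + h *m 1%:M = y + h *m 1%:M + c by rewrite addrAC.
by split=> qd eps eps0; have [dl dl0 [a Da]] := qd eps eps0; exists dl => //;
  exists a => h hdl; have := Da h hdl; rewrite key.
Qed.

Lemma quasi_diff_near (R : realType) (n : nat) (f g : 'rV[R]_n -> R) (x : 'rV[R]_n)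
    (U : set 'rV[R]_n) :
  open U -> U x -> (forall y, U y -> f y = g y) ->
  quasi_diff f 1%:M x -> quasi_diff g 1%:M x.
Proof.
move=> oU Ux fg qd eps eps0; have [dl dl0 [a Da]] := qd eps eps0.
have /nbhs_normP[dl' /= dl'0 dl'U] : nbhs x U by exact: open_nbhs_nbhs.
exists (Num.min dl dl'); first by rewrite lt_min dl0.
exists a => h; rewrite lt_min => /andP[hdl hdl'].
have := Da h hdl; rewrite !fg//; apply: dl'U => /=.
by rewrite mulmx1 opprD addNKr normrN.
Qed.

(** For fixed [t], the translate of [g i] by [t *: w] is again Lipschitz, so its exceptional slice
    is null; by Fubini almost every line in direction [w] is good for all [i], and [V], whose
    preimage has positive measure, meets such a line at its base point. *)
Lemma exists_ae_line (R : realType) (n : nat) (J : countType) (g : J -> 'rV[R]_n -> R)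
    (L : R) (w : 'rV[R]_n) (V : set 'rV[R]_n) :
  0 <= L -> (forall i x y, `|g i x - g i y| <= L * `|x - y|) ->
  open V -> V !=set0 ->
  exists2 x, V x & {ae lebesgue_measure, forall t : R,
    forall i, quasi_diff (g i) 1%:M (x + t *: w)}.
Proof.
move=> L0 g_lip oV V0.
have [dsp [T [mu [phi [mphi posphi radphi]]]]] := rademacher_model R n.
pose psi := fun p : measurableTypeR R * T => phi p.2 + p.1 *: w.
have mpsi U : open U -> measurable (psi @^-1` U).
  (* [psi] is the continuous map [kappa] applied to [row_mx t%:M (phi x)], whose measurability is
     known. *)
  move=> oU; pose kappa (u : 'rV[R]_(1 + n)) : 'rV[R]_n := u *m col_mx w 1%:M.
  have ckappa : continuous kappa.
    apply: (@lipschitz_continuous _ _ _ _ ((1 + n)%:R * `|col_mx w 1%:M|)) => y z /=.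
    by rewrite -mulmxBl; apply: le_trans (mulmx_norm_le _ _) _; rewrite mulrAC.
  have -> : psi @^-1` U = (fun p : measurableTypeR R * T => row_mx p.1%:M (phi p.2)) @^-1` (kappa @^-1` U).
    have psiE p : kappa (row_mx p.1%:M (phi p.2)) = psi p.
      by rewrite /kappa /psi mul_row_col mulmx1 mul_scalar_mx addrC.
    by apply/seteqP; split => p /=; rewrite psiE.
  have oK : open (kappa @^-1` U) by have /continuousP := ckappa; exact.
  exact: (measurable_row_mx_preimage mphi oK).
have cg i : continuous (g i) := lipschitz_continuous (g_lip i).
pose A i := [set p | ~ quasi_diff (g i) 1%:M (psi p)].
have mA i : measurable (A i) by exact: measurable_quasi_diff.
have A0 i : (@lebesgue_measure R \x mu)%E (A i) = 0%E.
  apply: product_null_xsection => t.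
  have gt_lip x y : `|g i (x + t *: w) - g i (y + t *: w)| <= L * `|x - y|.
    by apply: le_trans (g_lip _ _ _) _; rewrite opprD addrACA subrr addr0.
  rewrite -[RHS](radphi _ _ L0 gt_lip); congr (mu _).
  apply/seteqP; split => x; rewrite /xsection/= inE/=; apply: contra_not => qd.
    exact: (quasi_diff_shift (g i) (phi x) (t *: w)).2 qd.
  exact: (quasi_diff_shift (g i) (phi x) (t *: w)).1 qd.
have sec0 i : {ae mu, forall x, @lebesgue_measure R (ysection (A i) x) = 0%E}.
  have mf := @measurable_fun_ysection _ _ _ _ _ (@lebesgue_measure R) _ (mA i).
  have : (\int[mu]_(x in setT) `|(lebesgue_measure \o ysection (A i)) x|)%E = 0%E.
    rewrite -[RHS](A0 i) (@product_measure_unique _ _ _ _ _ (@lebesgue_measure R) mu (@lebesgue_measure R \x^ mu)%E)//.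
      by apply: eq_integral => x _; rewrite gee0_abs.
    by move=> B C mB mC; exact: product_measure2E.
  move=> /(ae_eq_integral_abs mu measurableT mf).
  by apply: filterS => x /= /(_ I).
have [x Vx sec] : exists2 x, V (phi x) & forall i, @lebesgue_measure R (ysection (A i) x) = 0%E.
  pose AA (k : nat) : set T := if unpickle k is Some i then
    [set x | @lebesgue_measure R (ysection (A i) x) <> 0%E] else set0.
  have negAA k : mu.-negligible (AA k).
    by rewrite /AA; case: unpickle => [i|]; [exact: sec0|exact: negligible_set0].
  apply: contrapT => noV.
  have : mu.-negligible (phi @^-1` V).
    apply: negligibleS (negligible_bigcup negAA) => x Vx; apply: contrapT => xA.
    apply: noV; exists x => // i; apply: contrapT => i0; apply: xA.
    by exists (pickle i) => //; rewrite /AA pickleK.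
  move=> /(measure_negligible (mphi _ oV)) V00.
  by have := posphi _ oV V0; rewrite V00 ltxx.
exists (phi x) => //.
pose BB (k : nat) : set (measurableTypeR R) := if unpickle k is Some i then
    ysection (A i) x else set0.
have negBB k : (@lebesgue_measure R).-negligible (BB k).
  rewrite /BB; case: unpickle => [i|]; last exact: negligible_set0.
  by apply/negligibleP; [exact: measurable_ysection|exact: sec].
apply: negligibleS (negligible_bigcup negBB) => t /= nqd.
apply: contrapT => noB; apply: nqd => i; apply: contrapT => nqd; apply: noB.
by exists (pickle i) => //; rewrite /BB pickleK /ysection/= inE.
Qed.

Lemma derive1_line (R : realType) (n p : nat) (G : 'rV[R]_n -> 'rV[R]_p)
    (x w : 'rV[R]_n) (xi : 'cV[R]_p) (t : R) :
  differentiable G (x + t *: w) ->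
  derive1 (fun s => (G (x + s *: w) *m xi) 0 0) t =
    ('d G (x + t *: w) w *m xi) 0 0.
Proof.
move=> dG; set P := x + t *: w in dG *.
pose ell (y : 'rV[R]_p) : R := (y *m xi) 0 0.
have cell : continuous ell.
  apply: (@lipschitz_continuous _ _ _ _ (p%:R * `|xi|)) => y z.
  have -> : ell y - ell z = ((y - z) *m xi) 0 0.
    by rewrite mulmxBl /ell; move: (y *m xi) (z *m xi) => M N; rewrite !mxE.
  apply: le_trans (mx_entry_le_norm _ _ _) _.
  by apply: le_trans (mulmx_norm_le _ _) _; rewrite mulrAC.
have dGw : h^-1 *: (G (h *: w + P) - G P) @[h --> 0^'] --> 'd G P w.
  by rewrite -deriveE//; exact: (diff_derivable dG).
have := cvg_comp _ _ dGw (cell _).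
rewrite derive1E /derive => lim_ell; apply: cvg_lim => //.
apply: cvg_trans lim_ell; apply: near_eq_cvg; near=> h => /=.
rewrite /ell.
have -> : x + (h *: 1 + t) *: w = h *: w + P.
  by rewrite -[h *: 1]/(h * 1) mulr1 scalerDl addrCA.
rewrite -scalemxAl mulmxBl.
by move: (G _ *m xi) (G P *m xi) => M N; rewrite !mxE.
Unshelve. all: by end_near. Qed.

Lemma clarke_mean_value (R : realType) (n p : nat) (F : 'rV[R]_n -> 'rV[R]_p)
    (L c : R) (U : set 'rV[R]_n) (z w : 'rV[R]_n) (xi : 'cV[R]_p) :
  open U ->
  (forall x, U x -> U (x + w) -> forall t, 0 <= t <= 1 -> U (x + t *: w)) ->
  0 <= L -> (forall x y, U x -> U y -> `|F x - F y| <= L * `|x - y|) ->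
  (forall x, U x -> differentiable F x -> c <= ('d F x w *m xi) 0 0) ->
  U z -> U (z + w) -> c <= ((F (z + w) - F z) *m xi) 0 0.
Proof.
move=> oU U_convex L0 F_lip dF_ge Uz Uzw.
(* Each component is extended from [U] to the whole space; as [U] is open, the extension has the
   same derivatives as [F] there. *)
have /choice[g gE] : forall i : 'I_p, exists g : 'rV[R]_n -> R,
    (forall x y, `|g x - g y| <= L * `|x - y|) /\ forall x, U x -> g x = F x 0 i.
  move=> i.
  have [|g g_lip gF] := @lipschitz_extension _ _ U (fun x => F x 0 i) L L0.
    move=> x y Ux Uy; apply: le_trans (F_lip _ _ Ux Uy).
    by apply: le_trans (mx_entry_le_norm _ 0 i); rewrite !mxE.
  by exists g.
pose G x := \row_i g i x.
have GF x : U x -> G x = F x.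
  by move=> Ux; apply/rowP => i; rewrite mxE; have [_ ->] := gE i.
have G_lip x y : `|G x - G y| <= L * `|x - y|.
  apply: mx_norm_le => [|i j]; first by rewrite mulr_ge0.
  by rewrite !mxE; have [+ _] := gE j; exact.
pose ell (y : 'rV[R]_p) : R := (y *m xi) 0 0.
have ellB y y' : ell y - ell y' = ell (y - y').
  by rewrite /ell mulmxBl; move: (y *m xi) (y' *m xi) => M N; rewrite !mxE.
have ell_le y : `|ell y| <= p%:R * `|xi| * `|y|.
  apply: le_trans (mx_entry_le_norm _ _ _) _.
  by apply: le_trans (mulmx_norm_le _ _) _; rewrite mulrAC.
(* A good parallel segment starts arbitrarily close to [z], with both ends still in [U]. *)
have near_x e : 0 < e -> exists x, `|z - x| < e /\ c <= ell (F (x + w) - F x) /\ U x /\ U (x + w).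
  move=> e0.
  pose V := [set x | `|x - z| < e] `&` (U `&` (fun x => x + w) @^-1` U).
  have oV : open V.
    apply: openI; first exact: open_norm_ball.
    apply: openI => //.
    have /continuousP : continuous (fun x : 'rV[R]_n => x + w).
      by move=> x; exact: (cvgD (@cvg_id _ _) (@cvg_cst _ _ _ _ _)).
    exact.
  have V0 : V !=set0 by exists z; split; [rewrite /= subrr normr0|split].
  have [x [xz [Ux Uxw]] aex] := exists_ae_line w L0 (fun i => (gE i).1) oV V0.
  exists x; split; first by rewrite distrC.
  split => //; rewrite -(GF _ Ux) -(GF _ Uxw) -ellB.
  pose h t := ell (G (x + t *: w)).
  have -> : ell (G (x + w)) - ell (G x) = h 1 - h 0 by rewrite /h scale1r scale0r addr0.
  have h_lip s t : `|h s - h t| <= (p%:R * `|xi| * (L * `|w|)) * `|s - t|.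
    rewrite /h ellB; apply: le_trans (ell_le _) _; rewrite -!mulrA ler_wpM2l// ler_wpM2l//.
    apply: le_trans (G_lip _ _) _; rewrite ler_wpM2l// opprD addrACA subrr add0r -scalerBl normrZ.
    by rewrite mulrC.
  rewrite -[c]mulr1 -{1}[1]subr0; apply: (lipschitz_mean_value h_lip) => //.
  move: aex; apply: filterS; first exact: (ae_filter_ringOfSetsType lebesgue_measure).
  move=> t qd /andP[t0 t1] _.
  have UP : U (x + t *: w) by apply: U_convex => //; rewrite !ltW.
  have dG : differentiable G (x + t *: w).
    apply: quasi_diff_differentiable => i.
    by apply: quasi_diff_near (openT) _ _ (qd i) => // y _; rewrite mxE.
  have dF : differentiable F (x + t *: w).
    apply: quasi_diff_differentiable => i.
    by apply: quasi_diff_near oU UP _ (qd i) => y Uy; have [_ ->] := gE i.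
  rewrite /h derive1_line// -deriveE//.
  rewrite (@near_eq_derive _ _ _ G F); first by rewrite deriveE//; exact: dF_ge.
  by have : nbhs (x + t *: w) U by [exact: open_nbhs_nbhs]; apply: filterS => y /GF.
apply/ler_addgt0Pr => e e0.
(* [ell] enlarges norms by at most [p * |xi|], and [F] changes by at most [L * |z - x|] at each of
   the two endpoints; the added 1 keeps [K] positive. *)
pose K := p%:R * `|xi| * (2 * L) + 1.
have K0 : 0 < K by rewrite /K ltr_wpDl// !mulr_ge0.
have [x [zx [cx [Ux Uxw]]]] := near_x (e / K) ltac:(by rewrite divr_gt0).
apply: le_trans cx _; rewrite -lerBlDl ellB.
apply: le_trans (ler_norm _) _; apply: le_trans (ell_le _) _.
have F_le : `|F (x + w) - F x - (F (z + w) - F z)| <= 2 * L * `|z - x|.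
  have subACA (a b a' b' : 'rV[R]_p) : a - b - (a' - b') = (a - a') - (b - b').
    by apply/rowP => i; rewrite !mxE; ring.
  rewrite subACA; apply: le_trans (ler_normB _ _) _.
  have := F_lip _ _ Uxw Uzw; have := F_lip _ _ Ux Uz.
  by rewrite opprD addrACA subrr addr0 (distrC z) => F1 F2; lra.
apply: (@le_trans _ _ (K * `|z - x|)).
  rewrite /K mulrDl mul1r.
  by rewrite -[leLHS]addr0 lerD// -!mulrA ler_wpM2l// ler_wpM2l// mulrA.
by rewrite mulrC -ler_pdivlMr// ltW.
Qed.

(** * The Euclidean norm and convex separation *)

Definition dot (R : realType) (q : nat) (x y : 'rV[R]_q) : R := (x *m y^T) 0 0.

Lemma dotE (R : realType) (q : nat) (x y : 'rV[R]_q) :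
  dot x y = \sum_(i < q) x 0 i * y 0 i.
Proof. by rewrite /dot mxE; apply: eq_bigr => i _; rewrite mxE. Qed.

Lemma dotC (R : realType) (q : nat) (x y : 'rV[R]_q) : dot x y = dot y x.
Proof. by rewrite !dotE; apply: eq_bigr => i _; rewrite mulrC. Qed.

Lemma dotDl (R : realType) (q : nat) (x y z : 'rV[R]_q) :
  dot (x + y) z = dot x z + dot y z.
Proof. by rewrite /dot mulmxDl mxE. Qed.

Lemma dotZl (R : realType) (q : nat) (a : R) (x y : 'rV[R]_q) :
  dot (a *: x) y = a * dot x y.
Proof. by rewrite /dot -scalemxAl mxE. Qed.

Lemma dotBl (R : realType) (q : nat) (x y z : 'rV[R]_q) :
  dot (x - y) z = dot x z - dot y z.
Proof. by rewrite dotDl -scaleN1r dotZl mulN1r. Qed.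

Lemma dotDr (R : realType) (q : nat) (x y z : 'rV[R]_q) :
  dot x (y + z) = dot x y + dot x z.
Proof. by rewrite !(dotC x) dotDl. Qed.

Lemma dotZr (R : realType) (q : nat) (a : R) (x y : 'rV[R]_q) :
  dot x (a *: y) = a * dot x y.
Proof. by rewrite !(dotC x) dotZl. Qed.

Lemma dotBr (R : realType) (q : nat) (x y z : 'rV[R]_q) :
  dot x (y - z) = dot x y - dot x z.
Proof. by rewrite !(dotC x) dotBl. Qed.

Lemma dot_mulmx (R : realType) (p q : nat) (x : 'rV[R]_p) (y : 'rV[R]_q)
    (A : 'M[R]_(p, q)) : dot (x *m A) y = dot x (y *m A^T).
Proof. by rewrite /dot trmx_mul trmxK mulmxA. Qed.

Lemma dot_ge0 (R : realType) (q : nat) (x : 'rV[R]_q) : 0 <= dot x x.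
Proof. by rewrite dotE; apply: sumr_ge0 => i _; rewrite -expr2 sqr_ge0. Qed.

Lemma dot_eq0 (R : realType) (q : nat) (x : 'rV[R]_q) : dot x x = 0 -> x = 0.
Proof.
rewrite dotE => /psumr_eq0P x0; apply/rowP => i; rewrite mxE.
have /eqP := x0 (fun i _ => ltac:(by rewrite -expr2 sqr_ge0)) i erefl.
by rewrite mulf_eq0 orbb => /eqP.
Qed.

Lemma enorm_ge0 (R : realType) (q : nat) (x : 'rV[R]_q) : 0 <= enorm x.
Proof. exact: sqrtr_ge0. Qed.

Lemma enormE (R : realType) (q : nat) (x : 'rV[R]_q) : enorm x = Num.sqrt (dot x x).
Proof. by rewrite /enorm dotE; congr Num.sqrt; apply: eq_bigr => i _; rewrite expr2. Qed.

Lemma sqr_enorm (R : realType) (q : nat) (x : 'rV[R]_q) : enorm x ^+ 2 = dot x x.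
Proof. by rewrite enormE sqr_sqrtr// dot_ge0. Qed.

Lemma enorm0 (R : realType) (q : nat) : enorm (0 : 'rV[R]_q) = 0.
Proof. by rewrite enormE /dot mul0mx mxE sqrtr0. Qed.

Lemma enorm_eq0 (R : realType) (q : nat) (x : 'rV[R]_q) : enorm x = 0 -> x = 0.
Proof. by move=> x0; apply: dot_eq0; rewrite -sqr_enorm x0 expr0n. Qed.

Lemma enormZ (R : realType) (q : nat) (a : R) (x : 'rV[R]_q) :
  enorm (a *: x) = `|a| * enorm x.
Proof.
by rewrite !enormE dotZl dotZr mulrA -expr2 sqrtrM ?sqr_ge0// sqrtr_sqr.
Qed.

Lemma enormN (R : realType) (q : nat) (x : 'rV[R]_q) : enorm (- x) = enorm x.
Proof. by rewrite -scaleN1r enormZ normrN1 mul1r. Qed.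

Lemma enorm_distC (R : realType) (q : nat) (x y : 'rV[R]_q) : enorm (x - y) = enorm (y - x).
Proof. by rewrite -enormN opprB. Qed.

Lemma cauchy_schwarz (R : realType) (q : nat) (x y : 'rV[R]_q) :
  dot x y <= enorm x * enorm y.
Proof.
have [y0|y0] := eqVneq (dot y y) 0.
  by rewrite (dot_eq0 y0) enorm0 mulr0 -(scale0r 0) dotZr mul0r.
have yy : 0 < dot y y by rewrite lt0r y0 dot_ge0.
have [xy|xy] := leP (dot x y) 0.
  by apply: le_trans xy _; rewrite mulr_ge0 ?enorm_ge0.
rewrite -(@ler_pXn2r _ 2) ?nnegrE ?mulr_ge0 ?enorm_ge0 ?(ltW xy)//.
rewrite exprMn !sqr_enorm.
have := dot_ge0 (dot y y *: x - dot x y *: y).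
rewrite dotBl !dotBr !dotZl !dotZr (dotC y x).
have -> : dot y y * (dot y y * dot x x) - dot y y * (dot x y * dot x y) -
   (dot x y * (dot y y * dot x y) - dot x y * (dot x y * dot y y)) =
   dot y y * (dot x x * dot y y - dot x y ^+ 2) by ring.
by rewrite pmulr_rge0// subr_ge0.
Qed.

Lemma enormD (R : realType) (q : nat) (x y : 'rV[R]_q) :
  enorm (x + y) <= enorm x + enorm y.
Proof.
rewrite -(@ler_pXn2r _ 2) ?nnegrE ?addr_ge0 ?enorm_ge0//.
rewrite sqrrD !sqr_enorm dotDl !dotDr (dotC y x).
by have := cauchy_schwarz x y; rewrite mulr2n; lra.
Qed.

Lemma enormB (R : realType) (q : nat) (x y : 'rV[R]_q) :
  enorm (x - y) <= enorm x + enorm y.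
Proof. by rewrite -(enormN y); exact: enormD. Qed.

Lemma enorm_distD (R : realType) (q : nat) (y x z : 'rV[R]_q) :
  enorm (x - z) <= enorm (x - y) + enorm (y - z).
Proof. by rewrite -[x in enorm (x - z)](subrK y) -addrA enormD. Qed.

Lemma norm_le_enorm (R : realType) (q : nat) (x : 'rV[R]_q) : `|x| <= enorm x.
Proof.
apply: mx_norm_le => [|i j]; first exact: enorm_ge0.
rewrite ord1 -sqrtr_sqr /enorm ler_wsqrtr// (bigD1 j)//= lerDl.
by apply: sumr_ge0 => k _; exact: sqr_ge0.
Qed.

Lemma enorm_le_norm (R : realType) (q : nat) (x : 'rV[R]_q) : enorm x <= q%:R * `|x|.
Proof.
have [->|x0] := eqVneq x 0; first by rewrite enorm0 normr0 mulr0.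
case: q x x0 => [|q] x x0; first by case/eqP: x0; apply/rowP => -[].
rewrite -(@ler_pXn2r _ 2) ?nnegrE ?enorm_ge0 ?mulr_ge0//.
rewrite sqr_enorm dotE exprMn.
apply: (@le_trans _ _ (\sum_(i < q.+1) `|x| ^+ 2)).
  apply: ler_sum => i _; rewrite -expr2 -real_normK ?num_real//.
  by rewrite lerXn2r ?nnegrE// mx_entry_le_norm.
rewrite sumr_const card_ord -[leLHS]mulr_natl ler_wpM2r ?sqr_ge0//.
by rewrite -natrX ler_nat -mulnn leq_pmulr.
Qed.

Lemma enorm_row_mx (R : realType) (p q : nat) (x : 'rV[R]_p) (y : 'rV[R]_q) :
  enorm (row_mx x y) <= enorm x + enorm y.
Proof.
rewrite -(@ler_pXn2r _ 2) ?nnegrE ?addr_ge0 ?enorm_ge0//.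
rewrite sqrrD !sqr_enorm /dot tr_row_mx mul_row_col mxE.
by rewrite -addrA lerD2l lerDr mulrn_wge0// mulr_ge0 ?enorm_ge0.
Qed.

Lemma enorm_row_mx0 (R : realType) (p q : nat) (x : 'rV[R]_p) :
  enorm (row_mx x (0 : 'rV[R]_q)) = enorm x.
Proof. by rewrite !enormE /dot tr_row_mx mul_row_col mul0mx addr0. Qed.

Lemma enorm_row_0mx (R : realType) (p q : nat) (x : 'rV[R]_q) :
  enorm (row_mx (0 : 'rV[R]_p) x) = enorm x.
Proof. by rewrite !enormE /dot tr_row_mx mul_row_col mul0mx add0r. Qed.

Lemma enorm_normalize (R : realType) (q : nat) (x : 'rV[R]_q) :
  x != 0 -> enorm ((enorm x)^-1 *: x) = 1.
Proof.
move=> x0; have ex : enorm x != 0 by apply: contra x0 => /eqP/enorm_eq0->.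
by rewrite enormZ ger0_norm ?invr_ge0 ?enorm_ge0// mulVf.
Qed.

Lemma enorm_dist_le (R : realType) (q : nat) (x y : 'rV[R]_q) :
  `|enorm x - enorm y| <= enorm (x - y).
Proof.
rewrite ler_norml; apply/andP; split.
  by have := enorm_distD x y 0; rewrite !subr0 enorm_distC; lra.
by have := enorm_distD y x 0; rewrite !subr0; lra.
Qed.

Lemma enorm_continuous (R : realType) (q : nat) : continuous (@enorm R q).
Proof.
apply: (@lipschitz_continuous _ _ _ _ q%:R) => x y.
exact: le_trans (enorm_dist_le _ _) (enorm_le_norm _).
Qed.

Lemma eballE (R : realType) (q : nat) (x z : 'rV[R]_q) (t : R) :
  0 < t -> eball x t z <-> enorm (z - x) < t.
Proof. by move=> t0; rewrite /eball gt_eqF. Qed.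

Lemma open_eball (R : realType) (q : nat) (x : 'rV[R]_q) (t : R) :
  0 < t -> open (eball x t).
Proof.
move=> t0; rewrite /eball gt_eqF//.
have /continuousP/(_ [set u | u < t]) : continuous (fun z : 'rV[R]_q => enorm (z - x)).
  move=> z; apply: (cvg_comp (fun z : 'rV[R]_q => z - x)); last exact: enorm_continuous.
  exact: (cvgB (@cvg_id _ _) (@cvg_cst _ _ _ _ _)).
by apply; exact: open_lt.
Qed.

Lemma eball_convex (R : realType) (q : nat) (x z w : 'rV[R]_q) (t s : R) :
  0 < t -> eball x t z -> eball x t (z + w) -> 0 <= s <= 1 -> eball x t (z + s *: w).
Proof.
move=> t0; rewrite !eballE// => zt zwt /andP[s0 s1].
have -> : z + s *: w - x = (1 - s) *: (z - x) + s *: (z + w - x).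
  by apply/rowP => i; rewrite !mxE; ring.
apply: le_lt_trans (enormD _ _) _; rewrite !enormZ ger0_norm ?subr_ge0// ger0_norm//.
have [->|s0'] := eqVneq s 0; first by rewrite subr0 mul1r mul0r addr0.
have sp : 0 < s by rewrite lt0r s0' s0.
have : s * enorm (z + w - x) < s * t by rewrite ltr_pM2l.
have : (1 - s) * enorm (z - x) <= (1 - s) * t by rewrite ler_wpM2l ?subr_ge0// ltW.
by lra.
Qed.

(** * Convex hulls and separation from the origin *)

Lemma convex_setP (R : realType) (E : lmodType R) (A : set E) :
  @convex_set R E A <->
  forall x y t, 0 <= t <= 1 -> A x -> A y -> A (t *: x + (1 - t) *: y).
Proof.
split=> [cA x y t /andP[t0 t1] Ax Ay|cA x y t].
  by have := cA x y (Itv01 t0 t1); rewrite !inE => /(_ Ax Ay).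
by rewrite !inE => Ax Ay; apply: cA => //; rewrite ge0 le1.
Qed.

Lemma convex_hull_sub (R : realType) (E : lmodType R) (A B : set E) :
  @convex_set R E B -> A `<=` B -> convex_hull A `<=` B.
Proof. exact: smallest_sub. Qed.

Lemma sub_convex_hull (R : realType) (E : lmodType R) (A : set E) :
  A `<=` convex_hull A.
Proof. exact: sub_gen_smallest. Qed.

Lemma convex_hull_convex (R : realType) (E : lmodType R) (A : set E) (x y : E) (t : R) :
  0 <= t <= 1 -> convex_hull A x -> convex_hull A y ->
  convex_hull A (t *: x + (1 - t) *: y).
Proof.
move=> t01 Ax Ay B BB; have [/= /convex_setP cB _] := BB.
by apply: cB => //; [exact: Ax|exact: Ay].
Qed.

Lemma compact_enorm_ball (R : realType) (q : nat) (x : 'rV[R]_q) (t : R) :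
  compact [set z | enorm (z - x) <= t].
Proof.
apply: bounded_closed_compact.
  exists (`|x| + t); split; first exact: num_real.
  move=> M Mt z /= zt; apply: le_trans (ltW Mt).
  rewrite -[z in `|z|](subrK x) addrC; apply: le_trans (ler_normD _ _) _.
  by rewrite lerD2l; apply: le_trans zt; exact: norm_le_enorm.
have /continuous_closedP/(_ [set u | u <= t]) : continuous (fun z : 'rV[R]_q => enorm (z - x)).
  move=> z; apply: (cvg_comp (fun z : 'rV[R]_q => z - x)); last exact: enorm_continuous.
  exact: (cvgB (@cvg_id _ _) (@cvg_cst _ _ _ _ _)).
by apply; exact: closed_le.
Qed.

(** The point [k0] of least norm in the closure of [K], normalized, gives [xi]: minimality along the
    segment towards [k] yields [dot k0 k0 <= dot k0 k]. The vector [e] supplies a direction when [K]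
    is empty. *)
Lemma convex_separation (R : realType) (q : nat) (K : set 'rV[R]_q) (c : R) (e : 'rV[R]_q) :
  enorm e = 1 ->
  (forall x y t, 0 <= t <= 1 -> K x -> K y -> K (t *: x + (1 - t) *: y)) ->
  0 < c -> (forall k, K k -> c <= enorm k) ->
  exists2 xi, enorm xi = 1 & forall k, K k -> c <= dot xi k.
Proof.
move=> e1 cK c0 Kc.
have [[k1 Kk1]|K0] := pselect (exists k, K k); last first.
  by exists e => // k Kk; case: K0; exists k.
(* Cutting with the ball of radius [enorm k1] makes the closure compact without losing its
   minimum. *)
pose A := [set x | enorm (x - 0) <= enorm k1] `&` closure K.
have cA : compact A.
  by apply: compact_closedI; [exact: compact_enorm_ball|exact: closed_closure].
have A0 : A !=set0 by exists k1; split; [rewrite /= subr0|exact: subset_closure].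
have [k0] := compact_EVT_min A0 cA (continuous_subspaceT (@enorm_continuous R q)).
rewrite inE => -[k0k1 clk0] minA.
have mink0 k : closure K k -> enorm k0 <= enorm k.
  move=> clk; have [kk1|/ltW kk1] := leP (enorm k) (enorm k1).
    by apply: minA; rewrite inE; split => //=; rewrite subr0.
  by move: k0k1; rewrite /= subr0 => /le_trans; exact.
have closure_le (g : 'rV[R]_q -> R) (b : R) : continuous g ->
    (forall x, K x -> b <= g x) -> forall x, closure K x -> b <= g x.
  move=> cg Kg; have cl : closed (g @^-1` [set u | b <= u]).
    by have /continuous_closedP := cg; apply; exact: closed_ge.
  by move=> x clx; apply: cl; apply: closure_subset clx.
have ck0 : c <= enorm k0 by exact: closure_le (@enorm_continuous R q) Kc _ clk0.
have ek0 : 0 < enorm k0 by apply: lt_le_trans ck0.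
exists ((enorm k0)^-1 *: k0).
  by apply: enorm_normalize; apply: contraTneq ek0 => ->; rewrite enorm0 ltxx.
move=> k Kk; suff kk0 : dot k0 k0 <= dot k0 k.
  rewrite dotZl -ler_pdivrMl ?invr_gt0// invrK; apply: le_trans kk0.
  by rewrite -sqr_enorm expr2 ler_wpM2l// ltW.
have seg t : 0 < t -> t <= 1 -> 0 <= 2 * dot k0 (k - k0) + t * dot (k - k0) (k - k0).
  move=> t0 t1.
  (* Convexity is known on [K], while [k0] lies in the closure; the bound is proved with a point of
     [K] in place of [k0] in the combination, then extended by continuity. *)
  have : enorm k0 <= enorm (t *: k + (1 - t) *: k0).
    apply: (closure_le (fun x => enorm (t *: k + (1 - t) *: x))) clk0.
      have caff : continuous (fun x : 'rV[R]_q => t *: k + (1 - t) *: x).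
        apply: (@lipschitz_continuous _ _ _ _ `|1 - t|) => x y.
        by rewrite opprD addrACA subrr add0r -scalerBr normrZ.
      by move=> x; exact: (cvg_comp _ _ (caff x) (@enorm_continuous _ _ _)).
    by move=> x Kx; apply: mink0; apply: subset_closure; apply: cK => //; rewrite ltW.
  rewrite -(@ler_pXn2r _ 2) ?nnegrE ?enorm_ge0// !sqr_enorm.
  have -> : t *: k + (1 - t) *: k0 = k0 + t *: (k - k0).
    by apply/rowP => i; rewrite !mxE; ring.
  move: (k - k0) => v; rewrite dotDl !dotDr !dotZl !dotZr (dotC v).
  rewrite -subr_ge0.
  have -> : dot k0 k0 + t * dot k0 v + (t * dot k0 v + t * (t * dot v v)) - dot k0 k0 =
    t * (2 * dot k0 v + t * dot v v) by ring.
  by rewrite pmulr_rge0.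
rewrite -subr_ge0 -dotBr; set b := dot _ _ in seg *; set a := dot _ _ in seg.
rewrite leNgt; apply/negP => b0.
have a0 : 0 <= a by exact: dot_ge0.
(* Small enough to give [2 * b + t * a < 0], against [seg]. *)
pose t := Num.min 1 (- b / (a + 1)).
have a1 : 0 < a + 1 by rewrite ltr_wpDl.
have t0 : 0 < t by rewrite lt_min ltr01 divr_gt0// oppr_gt0.
have t1 : t <= 1 by rewrite ge_min lexx.
have tb : t * (a + 1) <= - b by rewrite -ler_pdivlMr// ge_min lexx orbT.
have := seg t t0 t1; apply/negP; rewrite -ltNge.
by rewrite mulrDr mulr1 in tb; lra.
Qed.

(** * Operator norms and lower bounds for invertible matrices *)

Lemma enorm_mulmx_le (R : realType) (p q : nat) (x : 'rV[R]_p) (A : 'M[R]_(p, q)) :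
  enorm (x *m A) <= q%:R * (p%:R * `|A|) * enorm x.
Proof.
apply: le_trans (enorm_le_norm _) _; rewrite -!mulrA ler_wpM2l//.
apply: le_trans (mulmx_norm_le _ _) _; rewrite -!mulrA ler_wpM2l//.
by rewrite mulrC ler_wpM2l// norm_le_enorm.
Qed.

Lemma enorm_le_opnorm (R : realType) (p q : nat) (O : 'M[R]_(p, q)) (x : 'rV[R]_q) :
  enorm (x *m O^T) <= opnorm O * enorm x.
Proof.
have [->|x0] := eqVneq x 0; first by rewrite mul0mx !enorm0 mulr0.
have ex : 0 < enorm x.
  by rewrite lt0r enorm_ge0 andbT; apply: contra x0 => /eqP/enorm_eq0->.
have xE : x = enorm x *: ((enorm x)^-1 *: x) by rewrite scalerA mulfV ?scale1r// gt_eqF.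
rewrite {1}xE -scalemxAl enormZ ger0_norm ?enorm_ge0// mulrC ler_wpM2r ?enorm_ge0//.
apply: ub_le_sup; last by exists ((enorm x)^-1 *: x) => //=; exact: enorm_normalize.
exists (p%:R * (q%:R * `|O^T|)) => _ [y /= y1 <-].
by apply: le_trans (enorm_mulmx_le _ _) _; rewrite y1 mulr1.
Qed.

Lemma opnorm_ge0 (R : realType) (p q : nat) (O : 'M[R]_(p, q)) : 0 <= opnorm O.
Proof.
have [[x x1]|no] := pselect (exists x : 'rV[R]_q, enorm x = 1).
  by have := enorm_le_opnorm O x; rewrite x1 mulr1; apply: le_trans; exact: enorm_ge0.
rewrite /opnorm (_ : [set _ | _ in _] = set0) ?sup0//.
by rewrite -subset0 => _ [x /= x1 _]; apply: no; exists x.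
Qed.

Lemma opnorm_le (R : realType) (p q : nat) (O : 'M[R]_(p, q)) (c : R) :
  0 <= c -> (forall x : 'rV[R]_q, enorm x = 1 -> enorm (x *m O^T) <= c) -> opnorm O <= c.
Proof.
move=> c0 Oc.
have [[x x1]|no] := pselect (exists x : 'rV[R]_q, enorm x = 1).
  apply: ge_sup; first by exists (enorm (x *m O^T)); exists x.
  by move=> _ [y /= y1 <-]; exact: Oc.
rewrite /opnorm (_ : [set _ | _ in _] = set0) ?sup0//.
by rewrite -subset0 => _ [x /= x1 _]; apply: no; exists x.
Qed.

Lemma opnorm_inv_lower (R : realType) (p : nat) (P : 'M[R]_p) (c : R) (x : 'rV[R]_p) :
  P \in unitmx -> opnorm (invmx P) <= c -> enorm x <= c * enorm (x *m P^T).
Proof.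
move=> uP Pc.
have xE : x = (x *m P^T) *m (invmx P)^T by rewrite -mulmxA -trmx_mul mulVmx// trmx1 mulmx1.
rewrite {1}xE; apply: le_trans (enorm_le_opnorm _ _) _.
by rewrite ler_wpM2r ?enorm_ge0.
Qed.

(** A matrix and its transpose have the same operator norm, here through moving [B] to the other
    factor of [dot] and Cauchy-Schwarz. This transposed bound feeds the search for a descent
    direction. *)
Lemma opnorm_inv_lower_tr (R : realType) (p : nat) (P : 'M[R]_p) (c : R) (x : 'rV[R]_p) :
  P \in unitmx -> opnorm (invmx P) <= c -> enorm x <= c * enorm (x *m P).
Proof.
move=> uP Pc; pose y := x *m P; pose B := invmx P.
have xE : x = y *m B by rewrite /y /B -mulmxA mulmxV// mulmx1.
have [x0|x0] := eqVneq (enorm x) 0.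
  by rewrite x0 mulr_ge0 ?enorm_ge0// (le_trans (opnorm_ge0 _) Pc).
have ex : 0 < enorm x by rewrite lt0r x0 enorm_ge0.
have : enorm x ^+ 2 <= enorm y * (c * enorm x).
  rewrite sqr_enorm {1}xE dot_mulmx; apply: le_trans (cauchy_schwarz _ _) _.
  rewrite ler_wpM2l ?enorm_ge0//; apply: le_trans (enorm_le_opnorm _ _) _.
  by rewrite ler_wpM2r ?enorm_ge0.
by rewrite expr2 mulrA ler_pM2r// mulrC.
Qed.

Lemma lower_bound_unitmx (R : realType) (p : nat) (P : 'M[R]_p) (c : R) :
  0 < c -> (forall x, enorm x <= c * enorm (x *m P^T)) ->
  P \in unitmx /\ opnorm (invmx P) <= c.
Proof.
move=> c0 Pc.
have uP : P \in unitmx.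
  rewrite -unitmx_tr -row_free_unit; apply: inj_row_free => v vP0.
  apply: enorm_eq0; apply/eqP; rewrite eq_le enorm_ge0 andbT.
  by apply: le_trans (Pc v) _; rewrite vP0 enorm0 mulr0.
split => //; apply: opnorm_le => [|x x1]; first exact: ltW.
apply: le_trans (Pc _) _.
by rewrite -mulmxA -trmx_mul mulmxV// trmx1 mulmx1 x1 mulr1.
Qed.

(** * Partial Jacobians *)

(** [jacobian] acts on rows from the right, so the derivatives in [v] form its upper rows; the
    transpose makes them the left block [P] of a matrix [[P, Q]] in the generalized Jacobian. *)
Definition partial_jacobian (R : realType) (d m : nat)
    (F : 'rV[R]_(d + m) -> 'rV[R]_d) (x : 'rV[R]_(d + m)) : 'M[R]_d :=
  (usubmx (jacobian F x))^T.

Lemma diff_partial (R : realType) (d m : nat) (F : 'rV[R]_(d + m) -> 'rV[R]_d)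
    (x : 'rV[R]_(d + m)) (u : 'rV[R]_d) :
  differentiable F x -> 'd F x (row_mx u 0) = u *m (partial_jacobian F x)^T.
Proof.
move=> dF; rewrite -deriveE// deriveEjacobian// /partial_jacobian trmxK.
by rewrite -{1}(vsubmxK (jacobian F x)) mul_row_col mul0mx addr0.
Qed.

Lemma gen_jacobian_jacobian (R : realType) (q p : nat) (F : 'rV[R]_q -> 'rV[R]_p)
    (x : 'rV[R]_q) : differentiable F x -> gen_jacobian F x (jacobian F x)^T.
Proof.
move=> dF; apply: sub_convex_hull; exists (fun _ => x); split => //; exact: cvg_cst.
Qed.

Lemma gen_partial_jacobian_partial (R : realType) (d m : nat)
    (F : 'rV[R]_(d + m) -> 'rV[R]_d) (x : 'rV[R]_(d + m)) :
  differentiable F x -> gen_partial_jacobian F x (partial_jacobian F x).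
Proof.
move=> dF; exists (dsubmx (jacobian F x))^T; rewrite /partial_jacobian.
by rewrite -tr_col_mx vsubmxK; exact: gen_jacobian_jacobian.
Qed.

Lemma lipschitz_const_on_norm (R : realType) (q p : nat) (L : R) (A : set 'rV[R]_q)
    (F : 'rV[R]_q -> 'rV[R]_p) : lipschitz_const_on L A F ->
  forall x y, A x -> A y -> `|F x - F y| <= L * q%:R * `|x - y|.
Proof.
move=> [L0 F_lip] x y Ax Ay; apply: le_trans (norm_le_enorm _) _.
apply: le_trans (F_lip _ _ Ax Ay) _.
by rewrite -mulrA ler_wpM2l// enorm_le_norm.
Qed.

Lemma partial_mean_value (R : realType) (d m : nat) (F : 'rV[R]_(d + m) -> 'rV[R]_d)
    (L c t : R) (z0 z : 'rV[R]_(d + m)) (u xi : 'rV[R]_d) :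
  0 < t -> lipschitz_const_on L (eball z0 t) F ->
  (forall x, eball z0 t x -> differentiable F x ->
    c <= dot (u *m (partial_jacobian F x)^T) xi) ->
  eball z0 t z -> eball z0 t (z + row_mx u 0) ->
  c <= dot (F (z + row_mx u 0) - F z) xi.
Proof.
move=> t0 F_lip dF_ge zt zut; have [L0 _] := F_lip.
apply: (@clarke_mean_value _ _ _ _ (L * (d + m)%:R) _ (eball z0 t)) => //.
- exact: open_eball.
- by move=> x xt xut s s01; exact: eball_convex.
- by rewrite mulr_ge0.
- exact: lipschitz_const_on_norm.
- by move=> x xt dF; rewrite diff_partial//; exact: dF_ge.
Qed.

Lemma partial_lower_bound (R : realType) (d m : nat) (F : 'rV[R]_(d + m) -> 'rV[R]_d)
    (L lam t : R) (z0 z : 'rV[R]_(d + m)) (u : 'rV[R]_d) (Phi : set 'M[R]_d) :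
  0 < t -> lipschitz_const_on L (eball z0 t) F ->
  @convex_set R 'M[R]_d Phi ->
  (forall x, eball z0 t x -> differentiable F x -> Phi (partial_jacobian F x)) ->
  0 < lam -> (forall P x, Phi P -> enorm x <= lam * enorm (x *m P^T)) ->
  eball z0 t z -> eball z0 t (z + row_mx u 0) ->
  enorm u <= lam * enorm (F (z + row_mx u 0) - F z).
Proof.
move=> t0 F_lip /convex_setP cPhi FPhi lam0 Phi_ge zt zut.
have [->|u0] := eqVneq u 0; first by rewrite enorm0 mulr_ge0 ?enorm_ge0// ltW.
have eu : 0 < enorm u.
  by rewrite lt0r enorm_ge0 andbT; apply: contra u0 => /eqP/enorm_eq0->.
pose K := [set u *m P^T | P in Phi].
have [||//|xi xi1 Kxi] := @convex_separation _ _ K (enorm u / lam) _ (enorm_normalize u0).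
- move=> _ _ s s01 [P PhiP <-] [Q PhiQ <-]; exists (s *: P + (1 - s) *: Q).
    exact: cPhi.
  by rewrite raddfD/= !linearZ/= mulmxDr -!scalemxAr.
- by rewrite divr_gt0.
- by move=> _ [P PhiP <-]; rewrite ler_pdivrMr// mulrC Phi_ge.
rewrite mulrC -ler_pdivrMr//; apply: (@le_trans _ _ (dot (F (z + row_mx u 0) - F z) xi)).
  apply: (partial_mean_value t0 F_lip) => // x xt dF; rewrite dotC.
  by apply: Kxi; exists (partial_jacobian F x) => //; exact: FPhi.
by apply: le_trans (cauchy_schwarz _ _) _; rewrite xi1 mulr1.
Qed.

(** The same [u] serves every base point [z] and every step [s]; this uniformity permits starting
    from a point obtained by stepping back from a minimizer. *)
Lemma partial_descent (R : realType) (d m : nat) (F : 'rV[R]_(d + m) -> 'rV[R]_d)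
    (L lam t : R) (z0 : 'rV[R]_(d + m)) (xi : 'rV[R]_d) (Phi : set 'M[R]_d) :
  0 < t -> lipschitz_const_on L (eball z0 t) F ->
  @convex_set R 'M[R]_d Phi ->
  (forall x, eball z0 t x -> differentiable F x -> Phi (partial_jacobian F x)) ->
  0 < lam -> (forall P x, Phi P -> enorm x <= lam * enorm (x *m P)) ->
  xi != 0 ->
  exists2 u : 'rV[R]_d, enorm u = 1 & forall z s, 0 <= s -> eball z0 t z ->
    eball z0 t (z + row_mx (s *: u) 0) ->
    s * (enorm xi / lam) <= dot (F (z + row_mx (s *: u) 0) - F z) xi.
Proof.
move=> t0 F_lip /convex_setP cPhi FPhi lam0 Phi_ge xi0.
have exi : 0 < enorm xi.
  by rewrite lt0r enorm_ge0 andbT; apply: contra xi0 => /eqP/enorm_eq0->.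
pose K := [set xi *m P | P in Phi].
have [||//|u u1 Ku] := @convex_separation _ _ K (enorm xi / lam) _ (enorm_normalize xi0).
- move=> _ _ s s01 [P PhiP <-] [Q PhiQ <-]; exists (s *: P + (1 - s) *: Q).
    exact: cPhi.
  by rewrite mulmxDr -!scalemxAr.
- by rewrite divr_gt0.
- by move=> _ [P PhiP <-]; rewrite ler_pdivrMr// mulrC Phi_ge.
exists u => // z s s0 zt zst.
apply: (partial_mean_value t0 F_lip) => // x xt dF.
rewrite -scalemxAl dotZl ler_wpM2l// dot_mulmx trmxK.
by apply: Ku; exists (partial_jacobian F x) => //; exact: FPhi.
Qed.

(** * Limits of Jacobians and uniform separation near the base point *)

Lemma cvg_of_le_invn (R : realType) (V : normedModType R) (a : nat -> V) (l : V) :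
  (forall n, `|l - a n| <= n.+1%:R^-1) -> a @ \oo --> l.
Proof.
move=> al; apply/cvgrPdist_lt => e e0; near=> n.
apply: le_lt_trans (al n) _.
by near: n; exact: (near_infty_natSinv_lt (PosNum e0)).
Unshelve. all: by end_near. Qed.

(** A cluster point in a compact ball. The indices [k n] are not claimed to increase; [n <= k n] is
    enough to carry over limits of the original sequence. *)
Lemma compact_seq_subseq (R : realType) (q : nat) (a : nat -> 'rV[R]_q) (C : R) :
  (forall n, `|a n| <= C) ->
  exists (l : 'rV[R]_q) (k : nat -> nat),
    forall n, (n <= k n)%N /\ `|l - a (k n)| <= n.+1%:R^-1.
Proof.
move=> aC.
have cK : compact [set x : 'rV[R]_q | enorm (x - 0) <= q%:R * C] .
  by apply: compact_enorm_ball.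
have [|l [_ cl]] := cK (a @ \oo) _.
  exists 0%N => // n _; rewrite /= subr0; apply: le_trans (enorm_le_norm _) _.
  by rewrite ler_wpM2l ?aC.
have /choice[k kE] : forall n, exists k, (n <= k)%N /\ `|l - a k| <= n.+1%:R^-1.
  move=> n.
  have aA : (a @ \oo) [set a k | k in [set k | (n <= k)%N]].
    by exists n => // k /= nk; exists k.
  have lB : nbhs l [set y | `|y - l| < n.+1%:R^-1].
    apply: open_nbhs_nbhs; split; first exact: open_norm_ball.
    by rewrite /= subrr normr0 invr_gt0.
  have [_ [[k /= nk <-] lk]] := cl _ _ aA lB.
  by exists k; split => //; rewrite distrC; exact: ltW.
by exists l, k.
Qed.

Lemma jacobian_norm_le (R : realType) (q p : nat) (F : 'rV[R]_q -> 'rV[R]_p)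
    (C : R) (U : set 'rV[R]_q) (x : 'rV[R]_q) :
  open U -> 0 <= C -> (forall x y, U x -> U y -> `|F x - F y| <= C * `|x - y|) ->
  U x -> differentiable F x -> `|jacobian F x| <= C.
Proof.
move=> oU C0 F_lip Ux dF; apply: mx_norm_le => // i j.
pose w : 'rV[R]_q := delta_mx 0 i.
have w1 : `|w| <= 1.
  by apply: mx_norm_le => // i0 j0; rewrite mxE; case: (_ && _); rewrite ?normr1 ?normr0.
have -> : jacobian F x i j = ('D_w F x) 0 j.
  by rewrite deriveEjacobian// /w -rowE [RHS]mxE.
apply: le_trans (mx_entry_le_norm _ _ _) _.
have dw : h^-1 *: (F (h *: w + x) - F x) @[h --> 0^'] --> 'D_w F x := diff_derivable dF.
apply/ler_addgt0Pr => e e0.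
have cont : continuous (fun h : R => h *: w + x).
  apply: (@lipschitz_continuous R R^o _ _ `|w|) => s t.
  by rewrite opprD addrACA subrr addr0 -scalerBl normrZ mulrC.
have := cont 0; rewrite /continuous_at scale0r add0r => cont0.
near (0 : R)^' => h.
have dwe : `|'D_w F x - h^-1 *: (F (h *: w + x) - F x)| <= e.
  by near: h; exact: cvgr_dist_le dw _ e0.
rewrite -['D_w F x](subrK (h^-1 *: (F (h *: w + x) - F x))) addrC.
apply: le_trans (ler_normD _ _) _; apply: lerD => //.
have h0 : h != 0 by near: h; exact: nbhs_dnbhs_neq.
have Uh : U (h *: w + x).
  near: h; apply: nbhs_dnbhs; apply: cont0; exact: open_nbhs_nbhs.
rewrite normrZ normfV ler_pdivrMl ?normr_gt0//.
apply: le_trans (F_lip _ _ Uh Ux) _; rewrite addrK normrZ mulrCA ler_wpM2l// -[leRHS]mulr1.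
by rewrite ler_wpM2l.
Unshelve. all: by end_near. Qed.

Lemma norm_trmx (R : realType) (m n : nat) (A : 'M[R]_(m, n)) : `|A^T| = `|A|.
Proof.
have le (p q : nat) (B : 'M[R]_(p, q)) : `|B^T| <= `|B|.
  by apply: mx_norm_le => // i j; rewrite mxE mx_entry_le_norm.
by apply/eqP; rewrite eq_le le/= -{1}[A]trmxK le.
Qed.

Lemma norm_lsubmx (R : realType) (m n1 n2 : nat) (A : 'M[R]_(m, n1 + n2)) :
  `|lsubmx A| <= `|A|.
Proof. by apply: mx_norm_le => // i j; rewrite mxE mx_entry_le_norm. Qed.

Lemma norm_mxvec (R : realType) (m n : nat) (A : 'M[R]_(m, n)) : `|mxvec A| = `|A|.
Proof.
apply/eqP; rewrite eq_le; apply/andP; split; apply: mx_norm_le => // i j.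
  by case/mxvec_indexP: j => j k; rewrite !ord1 mxvecE mx_entry_le_norm.
by rewrite -mxvecE mx_entry_le_norm.
Qed.

Lemma dot_mulmx_tr_le (R : realType) (d : nat) (u xi : 'rV[R]_d) (A : 'M[R]_d) :
  `|dot (u *m A^T) xi| <= d%:R * (d%:R * `|A|) * enorm u * enorm xi.
Proof.
have le y : dot y xi <= enorm y * enorm xi := cauchy_schwarz y xi.
have A_le : enorm (u *m A^T) * enorm xi <= d%:R * (d%:R * `|A|) * enorm u * enorm xi.
  by rewrite ler_wpM2r ?enorm_ge0// -(norm_trmx A) enorm_mulmx_le.
rewrite ler_norml; apply/andP; split; last exact: le_trans (le _) A_le.
rewrite lerNl -mulN1r -dotZl; apply: le_trans (le _) _.
by rewrite enormZ normrN1 mul1r.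
Qed.

Lemma partial_jacobian_norm_le (R : realType) (d m : nat)
    (F : 'rV[R]_(d + m) -> 'rV[R]_d) (L t : R) (z0 x : 'rV[R]_(d + m)) :
  0 < t -> lipschitz_const_on L (eball z0 t) F -> eball z0 t x ->
  differentiable F x -> `|jacobian F x| <= L * (d + m)%:R.
Proof.
move=> t0 F_lip xt dF; have [L0 _] := F_lip.
apply: (@jacobian_norm_le _ _ _ _ _ (eball z0 t)) => //.
- exact: open_eball.
- by rewrite mulr_ge0.
- exact: lipschitz_const_on_norm.
Qed.

(* Near z0 the inner product with the separating direction xi of the set
   {P u} stays bounded below: otherwise Jacobians at points tending to z0
   would accumulate at an element of the generalized Jacobian violating the
   separation. *)
Lemma local_partial_separation (R : realType) (d m : nat)
    (F : 'rV[R]_(d + m) -> 'rV[R]_d) (L r c2 c1 : R) (z0 : 'rV[R]_(d + m))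
    (u : 'rV[R]_d) :
  0 < r -> lipschitz_const_on L (eball z0 r) F ->
  0 < c1 -> c1 < c2 -> enorm u = 1 ->
  (forall P, gen_partial_jacobian F z0 P -> c2 <= enorm (u *m P^T)) ->
  exists2 xi, enorm xi = 1 & exists2 t, 0 < t <= r &
    forall x, eball z0 t x -> differentiable F x ->
      c1 <= dot (u *m (partial_jacobian F x)^T) xi.
Proof.
move=> r0 F_lip c10 c12 u1 S_ge; have [L0 _] := F_lip.
pose K := [set u *m P^T | P in gen_partial_jacobian F z0].
have [||k|xi xi1 Kxi] := @convex_separation _ _ K c2 u u1.
- move=> _ _ s s01 [P [Q PQ] <-] [P' [Q' PQ'] <-].
  exists (s *: P + (1 - s) *: P').
    exists (s *: Q + (1 - s) *: Q').
    have := convex_hull_convex s01 PQ PQ'.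
    by rewrite !scale_row_mx add_row_mx.
  by rewrite raddfD/= !linearZ/= mulmxDr -!scalemxAr.
- exact: lt_trans c12.
- by move=> [P SP <-]; exact: S_ge.
exists xi => //; apply: contrapT => no_t.
have /choice[x xE] : forall k : nat, exists x, [/\ eball z0 (Num.min r k.+1%:R^-1) x,
    differentiable F x & dot (u *m (partial_jacobian F x)^T) xi < c1].
  move=> k; apply: contrapT => no_x; apply: no_t.
  exists (Num.min r k.+1%:R^-1); first by rewrite lt_min r0 invr_gt0 ltr0n ge_min lexx.
  move=> x xt dF; rewrite leNgt; apply/negP => lt_c1; apply: no_x.
  by exists x.
have min0 k : 0 < Num.min r k.+1%:R^-1 by rewrite lt_min r0 invr_gt0/=.
have xr k : eball z0 r (x k).
  have [+ _ _] := xE k; rewrite !eballE// => xk; apply: lt_le_trans xk _.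
  by rewrite ge_min lexx.
pose J k : 'M[R]_(d, d + m) := (jacobian F (x k))^T.
(* The Lipschitz constant bounds the Jacobians, and [mxvec] turns them into rows, for which
   compactness is available. *)
have J_le k : `|mxvec (J k)| <= L * (d + m)%:R.
  rewrite norm_mxvec norm_trmx; have [_ dF _] := xE k.
  exact: partial_jacobian_norm_le F_lip _ _.
have [v [k kE]] := compact_seq_subseq J_le.
pose Jl : 'M[R]_(d, d + m) := vec_mx v.
have JlE n : `|Jl - J (k n)| <= n.+1%:R^-1.
  rewrite -norm_mxvec linearB/= /Jl vec_mxK; have [] := kE n; by [].
have GJl : gen_jacobian F z0 Jl.
  apply: sub_convex_hull; exists (x \o k); split.
  - apply: cvg_of_le_invn => n /=; apply: le_trans (norm_le_enorm _) _.
    rewrite enorm_distC; have [+ _ _] := xE (k n); rewrite eballE// => /ltW xk.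
    apply: le_trans xk _; rewrite ge_min; apply/orP; right.
    by rewrite lef_pV2 ?posrE// ler_nat; have [] := kE n.
  - by move=> h /=; have [] := xE (k h).
  - exact: cvg_of_le_invn.
have SP : gen_partial_jacobian F z0 (lsubmx Jl).
  by exists (rsubmx Jl); rewrite hsubmxK.
have c2_le : c2 <= dot (u *m (lsubmx Jl)^T) xi.
  by rewrite dotC; apply: Kxi; exists (lsubmx Jl).
(* The values below [c1] pass to the limit up to [e]; [D] absorbs the factor [d * d] between the max
   norm of a matrix and the inner product. *)
have : dot (u *m (lsubmx Jl)^T) xi <= c1.
  apply/ler_addgt0Pr => e e0.
  pose D := (d * d).+1%:R : R.
  have D0 : 0 < D by [].
  have [n nE] := inv_natS_lt (divr_gt0 e0 D0).
  have -> : lsubmx Jl = partial_jacobian F (x (k n)) + lsubmx (Jl - J (k n)).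
    by rewrite raddfB/= addrC /J /partial_jacobian trmx_usub subrK.
  rewrite raddfD/= mulmxDr dotDl; apply: lerD.
    by have [_ _ /ltW] := xE (k n).
  apply: le_trans (ler_norm _) _; apply: le_trans (dot_mulmx_tr_le _ _ _) _.
  rewrite u1 xi1 !mulr1 mulrA -natrM.
  apply: (@le_trans _ _ (D * n.+1%:R^-1)).
    apply: ler_pM => //; first by rewrite /D ler_nat.
    by apply: le_trans (norm_lsubmx _) (JlE n).
  by rewrite mulrC -ler_pdivlMr// ltW.
by apply/negP; rewrite -ltNge; exact: lt_le_trans c12 c2_le.
Qed.

Lemma compact_sphere (R : realType) (q : nat) : compact [set u : 'rV[R]_q | enorm u = 1].
Proof.
apply: (@subclosed_compact _ _ [set u : 'rV[R]_q | enorm (u - 0) <= 1]).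
- have /continuous_closedP := @enorm_continuous R q.
  by move=> /(_ [set 1]); apply; exact: closed_eq.
- exact: compact_enorm_ball.
- by move=> u /= u1; rewrite subr0 u1.
Qed.

(** A direction [xi] found for [u] stays good for nearby [u'] at the cost of lowering [c1] to [c0],
    because the Jacobians are uniformly bounded; compactness of the sphere then gives one radius for
    all [u]. *)
Lemma uniform_partial_separation (R : realType) (d m : nat)
    (F : 'rV[R]_(d + m) -> 'rV[R]_d) (L r c2 c1 c0 : R) (z0 : 'rV[R]_(d + m)) :
  0 < r -> lipschitz_const_on L (eball z0 r) F ->
  0 < c0 -> c0 < c1 -> c1 < c2 ->
  (forall P u, enorm u = 1 -> gen_partial_jacobian F z0 P -> c2 <= enorm (u *m P^T)) ->
  exists2 t, 0 < t <= r & forall u, enorm u = 1 ->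
    exists2 xi, enorm xi = 1 &
    forall x, eball z0 t x -> differentiable F x ->
      c0 <= dot (u *m (partial_jacobian F x)^T) xi.
Proof.
move=> r0 F_lip c00 c01 c12 S_ge; have [L0 _] := F_lip.
pose Q t u := exists2 xi, enorm xi = 1 & forall x, eball z0 t x ->
   differentiable F x -> c0 <= dot (u *m (partial_jacobian F x)^T) xi.
(* Bounds the change of the inner product per unit change of [u], uniformly over the Jacobians in
   the ball; the added 1 makes it positive. *)
pose C := d%:R * (d%:R * (L * (d + m)%:R)) + 1.
have C0 : 0 < C by rewrite /C ltr_wpDl// !mulr_ge0.
have cov u : [set u : 'rV[R]_d | enorm u = 1] u ->
    \forall u' \near u & t \near (0 : R)^'+, Q t u'.
  move=> /= u1.
  have [|xi xi1 [t /andP[t0 tr] tE]] :=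
    @local_partial_separation _ _ _ F L r c2 c1 z0 u r0 F_lip _ c12 u1 (fun P => S_ge P u u1).
    exact: lt_trans c01.
  pose kap := (c1 - c0) / C.
  have kap0 : 0 < kap by rewrite divr_gt0// subr_gt0.
  exists (eball u kap, [set t' | 0 < t' < t]).
    split => /=; last first.
      near=> t'; apply/andP; split; near: t'; [exact: nbhs_right_gt|exact: nbhs_right_lt].
    apply: open_nbhs_nbhs; split; first exact: open_eball.
    by rewrite eballE// subrr enorm0.
  move=> [u' t'] [/= u'u /andP[t'0 t't]]; rewrite eballE// in u'u.
  exists xi => // x xt' dF.
  have xt : eball z0 t x by rewrite eballE//; rewrite eballE// in xt'; exact: lt_trans t't.
  have xr : eball z0 r x by rewrite eballE//; rewrite eballE// in xt; exact: lt_le_trans tr.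
  have J_le := partial_jacobian_norm_le r0 F_lip xr dF.
  have P_le : `|partial_jacobian F x| <= L * (d + m)%:R.
    rewrite /partial_jacobian trmx_usub; apply: le_trans (norm_lsubmx _) _.
    by rewrite norm_trmx.
  rewrite -[u'](subrK u) mulmxDl dotDl.
  have := tE x xt dF.
  have : `|dot ((u' - u) *m (partial_jacobian F x)^T) xi| <= c1 - c0.
    apply: le_trans (dot_mulmx_tr_le _ _ _) _; rewrite xi1 mulr1.
    apply: (@le_trans _ _ (C * kap)); last by rewrite /kap mulrCA mulfV ?mulr1// gt_eqF.
    apply: ler_pM; rewrite ?mulr_ge0 ?enorm_ge0//; last exact: ltW.
    by rewrite /C -[leLHS]addr0 lerD// ler_wpM2l// ler_wpM2l.
  by rewrite ler_norml => /andP[+ _]; lra.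
have /compact_near_coveringP/(_ _ ((0 : R)^'+) Q _ cov) := @compact_sphere R d.
move=> nearQ; near (0 : R)^'+ => t.
have Qt : [set u | enorm u = 1] `<=` Q t by near: t.
exists t; last by move=> u u1; exact: Qt.
by apply/andP; split; near: t; [exact: nbhs_right_gt|exact: nbhs_right_le].
Unshelve. all: by end_near. Qed.

Lemma mxset_norm_ge0 (R : realType) (p q : nat) (V : set 'M[R]_(p, q)) :
  mxset_bounded V -> 0 <= mxset_norm V.
Proof.
move=> Vb; have [[v Vv]|V0] := pselect (exists v, V v).
  apply: le_trans (opnorm_ge0 v) _; apply: ub_le_sup => //.
  by exists v.
rewrite /mxset_norm (_ : [set _ | _ in _] = set0) ?sup0//.
by rewrite -subset0 => _ [v /= Vv _]; apply: V0; exists v.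
Qed.

Lemma mxset_inv_opnorm_le (R : realType) (p : nat) (V : set 'M[R]_p) (P : 'M[R]_p) :
  mxset_bounded (mxset_inv V) -> V P -> opnorm (invmx P) <= mxset_norm (mxset_inv V).
Proof.
move=> Vb VP; apply: ub_le_sup => //; exists (invmx P) => //.
by exists P.
Qed.

Lemma mxset_inv_norm_le (R : realType) (p : nat) (V : set 'M[R]_p) (c : R) :
  0 <= c -> (forall P, V P -> opnorm (invmx P) <= c) ->
  mxset_bounded (mxset_inv V) /\ mxset_norm (mxset_inv V) <= c.
Proof.
move=> c0 Vc.
have ub : ubound [set opnorm v | v in mxset_inv V] c by move=> _ [_ [P VP <-] <-]; exact: Vc.
split; first by exists c.
have [[P VP]|V0] := pselect (exists v, V v).
  by apply: ge_sup => //; exists (opnorm (invmx P)); exists (invmx P) => //; exists P.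
rewrite /mxset_norm (_ : [set _ | _ in _] = set0) ?sup0//.
by rewrite -subset0 => _ [_ /= [P VP _] _]; apply: V0; exists P.
Qed.

(** The inequality defines a closed convex half-space of matrices, so it passes from Jacobians at
    points near [z] to their limits and then to the convex hull. *)
Lemma gen_partial_jacobian_halfspace (R : realType) (d m : nat)
    (F : 'rV[R]_(d + m) -> 'rV[R]_d) (t c : R) (z0 z : 'rV[R]_(d + m))
    (u xi : 'rV[R]_d) (P : 'M[R]_d) :
  0 < t -> eball z0 t z ->
  (forall x, eball z0 t x -> differentiable F x ->
    c <= dot (u *m (partial_jacobian F x)^T) xi) ->
  gen_partial_jacobian F z P -> c <= dot (u *m P^T) xi.
Proof.
move=> t0 zt F_ge [Q PQ].
pose phi (J : 'M[R]_(d, d + m)) := dot (u *m (lsubmx J)^T) xi.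
have phiD J J' : phi (J + J') = phi J + phi J'.
  by rewrite /phi raddfD/= raddfD/= mulmxDr dotDl.
have phiZ a J : phi (a *: J) = a * phi J.
  by rewrite /phi linearZ/= linearZ/= -scalemxAr dotZl.
suff : [set J | c <= phi J] (row_mx P Q) by rewrite /= /phi row_mxKl.
apply: convex_hull_sub PQ.
  apply/convex_setP => J J' s /andP[s0 s1] /= cJ cJ'.
  rewrite phiD !phiZ.
  have := ler_wpM2l s0 cJ; have := @ler_wpM2l _ (1 - s) _ _ _ cJ'.
  by rewrite subr_ge0 => /(_ s1); lra.
move=> J [x [xz dF JE]] /=; apply/ler_addgt0Pr => e e0.
pose C := d%:R * d%:R * enorm u * enorm xi + 1.
have C0 : 0 < C by rewrite /C ltr_wpDl// !mulr_ge0 ?enorm_ge0.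
have eC : 0 < e / C by rewrite divr_gt0.
have nearJ : \forall h \near \oo, `|J - (jacobian F (x h))^T| <= e / C.
  have /cvgrPdist_le/(_ _ eC) : (fun h => (jacobian F (x h))^T) @ \oo --> J by exact: JE.
  exact.
near \oo => h.
have xh : eball z0 t (x h).
  by near: h; apply: xz; apply: open_nbhs_nbhs; split; [exact: open_eball|].
have Jh : `|J - (jacobian F (x h))^T| <= e / C.
  by near: h.
have := F_ge _ xh (dF h).
have -> : dot (u *m (partial_jacobian F (x h))^T) xi = phi ((jacobian F (x h))^T).
  by rewrite /phi /partial_jacobian trmx_usub.
set Jx := (jacobian F (x h))^T in Jh *.
have -> : phi Jx = phi J - phi (J - Jx).
  by rewrite phiD -[- Jx]scaleN1r phiZ; ring.
have phi_le : `|phi (J - Jx)| <= e.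
  apply: le_trans (dot_mulmx_tr_le _ _ _) _.
  apply: (@le_trans _ _ (C * (e / C))); last by rewrite mulrCA mulfV ?mulr1// gt_eqF.
  have -> : d%:R * (d%:R * `|lsubmx (J - Jx)|) * enorm u * enorm xi =
    d%:R * d%:R * enorm u * enorm xi * `|lsubmx (J - Jx)| by ring.
  apply: ler_pM; rewrite ?mulr_ge0 ?enorm_ge0//; first by rewrite /C lerDl.
  exact: le_trans (norm_lsubmx _) Jh.
by move: phi_le; rewrite ler_norml => /andP[+ _]; lra.
Unshelve. all: by end_near. Qed.

(** Makes the supremum defining [delta] run over a nonempty set, so that it is positive and not the
    default value 0. For each [u] a single half-space contains all partial Jacobians over the ball,
    hence also their hull. *)
Lemma hull_on_ball_regular (R : realType) (d m : nat)
    (F : 'rV[R]_(d + m) -> 'rV[R]_d) (L r lam : R) (z0 : 'rV[R]_(d + m)) :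
  0 < r -> lipschitz_const_on L (eball z0 r) F ->
  mxset_invertible (gen_partial_jacobian F z0) ->
  mxset_bounded (mxset_inv (gen_partial_jacobian F z0)) ->
  mxset_norm (mxset_inv (gen_partial_jacobian F z0)) < lam ->
  exists2 e, 0 < e <= r & forall t, 0 <= t < e ->
    let phi := hull_on_ball (gen_partial_jacobian F) z0 t in
    [/\ mxset_invertible phi, mxset_bounded (mxset_inv phi)
      & mxset_norm (mxset_inv phi) <= lam].
Proof.
move=> r0 F_lip S_unit S_bnd; set M := mxset_norm _ => Mlam.
have M0 : 0 <= M by exact: mxset_norm_ge0.
have lam0 : 0 < lam by exact: le_lt_trans Mlam.
(* Since [M < lam2 < lam1 < lam], the inverses of the last three are the thresholds of
   [uniform_partial_separation]: one gap pays for passing to limits, the other for moving [u]. *)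
pose lam1 := (M + 2 * lam) / 3; pose lam2 := (2 * M + lam) / 3.
have lam20 : 0 < lam2 by rewrite /lam2; lra.
have lam21 : lam2 < lam1 by rewrite /lam2 /lam1; lra.
have lam1l : lam1 < lam by rewrite /lam1; lra.
have Mlam2 : M <= lam2 by rewrite /lam2; lra.
have lam10 : 0 < lam1 by exact: lt_trans lam21.
have [|||P u u1 SP|e e0 eE] := @uniform_partial_separation _ _ _ F L r lam2^-1 lam1^-1 lam^-1 z0 r0 F_lip.
- by rewrite invr_gt0.
- by rewrite ltf_pV2.
- by rewrite ltf_pV2.
- rewrite -[lam2^-1]mul1r ler_pdivrMr// -u1 mulrC; apply: opnorm_inv_lower; first exact: S_unit.
  by apply: le_trans Mlam2; exact: mxset_inv_opnorm_le.
exists e => // t /andP[t0 te] phi.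
have e00 : 0 < e by case/andP: e0.
have phi_lower P : phi P -> P \in unitmx /\ opnorm (invmx P) <= lam.
  move=> phiP; apply: lower_bound_unitmx => // u.
  have [->|u0] := eqVneq u 0; first by rewrite enorm0 mulr_ge0 ?enorm_ge0// ltW.
  have eu : 0 < enorm u.
    by rewrite lt0r enorm_ge0 andbT; apply: contra u0 => /eqP/enorm_eq0->.
  have [xi xi1 xiE] := eE _ (enorm_normalize u0).
  pose B := [set P : 'M[R]_d | lam^-1 <= dot (((enorm u)^-1 *: u) *m P^T) xi].
  have : B P.
    apply: convex_hull_sub phiP.
      apply/convex_setP => A A' s /andP[s0 s1] /= cA cA'.
      move: cA cA'; rewrite /B/=; set v := _ *: u => cA cA'.
      rewrite raddfD/= !linearZ/= mulmxDr -!scalemxAr dotDl !dotZl.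
      have := ler_wpM2l s0 cA; have := @ler_wpM2l _ (1 - s) _ _ _ cA'.
      by rewrite subr_ge0 => /(_ s1); lra.
    move=> A [z zt SA]; apply: (gen_partial_jacobian_halfspace e00 _ xiE SA).
    (* At [t = 0] the ball is by convention the single point [z0], which the open ball of radius [e]
       contains. *)
    apply/(eballE _ _ e00); move: zt; rewrite /eball; case: ifP => [_ /= zz|_ /= zt].
      by rewrite zz subrr enorm0.
    exact: lt_trans te.
  rewrite /B /= => BP; have := le_trans BP (cauchy_schwarz _ _).
  rewrite xi1 mulr1 -scalemxAl enormZ ger0_norm ?invr_ge0 ?enorm_ge0//.
  by rewrite mulrC ler_pdivlMr// ler_pdivrMl.
have [bnd le_lam] : mxset_bounded (mxset_inv phi) /\ mxset_norm (mxset_inv phi) <= lam.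
  by apply: mxset_inv_norm_le => [|P /phi_lower[]//]; exact: ltW.
by split => // P /phi_lower[].
Qed.

(** * Zeros by minimization, and the implicit function *)

Lemma lipschitz_within_continuous (R : realType) (V W : normedModType R)
    (A : set V) (f : V -> W) (C : R) :
  (forall x y, A x -> A y -> `|f x - f y| <= C * `|x - y|) ->
  {within A, continuous f}.
Proof.
move=> f_lip; apply/subspace_continuousP => x Ax; apply/cvgrPdist_le => e e0.
have C1 : 0 < `|C| + 1 by rewrite ltr_wpDl.
rewrite near_withinE; near=> y => Ay; apply: le_trans (f_lip _ _ Ax Ay) _.
apply: (@le_trans _ _ ((`|C| + 1) * `|x - y|)).
  by rewrite ler_wpM2r// (le_trans (ler_norm C))// lerDl.
rewrite mulrC -ler_pdivlMr//.
by near: y; apply: cvgr_dist_le; [exact: cvg_id|rewrite divr_gt0].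
Unshelve. all: by end_near. Qed.

(* A minimizer of |F(., y)| over the closed eta-ball about v0 is interior by
   the lower bound on increments, and then a zero because otherwise
   [partial_descent] would provide a descent direction. *)
Lemma partial_zero_exists (R : realType) (d m : nat)
    (F : 'rV[R]_(d + m) -> 'rV[R]_d) (L lam rho eta : R) (v0 : 'rV[R]_d)
    (z0 : 'rV[R]_(d + m)) (y : 'rV[R]_m) (Phi : set 'M[R]_d) :
  0 < rho -> lipschitz_const_on L (eball z0 rho) F ->
  @convex_set R 'M[R]_d Phi ->
  (forall x, eball z0 rho x -> differentiable F x -> Phi (partial_jacobian F x)) ->
  0 < lam ->
  (forall P x, Phi P -> enorm x <= lam * enorm (x *m P^T)) ->
  (forall P x, Phi P -> enorm x <= lam * enorm (x *m P)) ->
  0 < eta -> (forall v, enorm (v - v0) <= eta -> eball z0 rho (row_mx v y)) ->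
  2 * lam * enorm (F (row_mx v0 y)) < eta ->
  exists2 v, enorm (v - v0) < eta & F (row_mx v y) = 0.
Proof.
move=> rho0 F_lip cPhi FPhi lam0 Phi_ge Phi_geT eta0 inball small.
have [L0 F_lip'] := F_lip.
pose G v := F (row_mx v y); pose C := [set v | enorm (v - v0) <= eta].
have Cv0 : C v0 by rewrite /C/= subrr enorm0 ltW.
have rowB (v w : 'rV[R]_d) : row_mx v y - row_mx w y = row_mx (v - w) 0.
  by rewrite opp_row_mx add_row_mx subrr.
have rowD (v w : 'rV[R]_d) : row_mx v y + row_mx w 0 = row_mx (v + w) y.
  by rewrite add_row_mx addr0.
have G_lip v w : C v -> C w -> enorm (G v - G w) <= L * enorm (v - w).
  move=> /inball bv /inball bw; apply: le_trans (F_lip' _ _ bv bw) _.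
  by rewrite rowB enorm_row_mx0.
have G_low v w : C v -> C w -> enorm (v - w) <= lam * enorm (G v - G w).
  move=> /inball bv /inball bw.
  have := @partial_lower_bound _ _ _ F L lam rho z0 (row_mx w y) (v - w) Phi rho0 F_lip
    cPhi FPhi lam0 Phi_ge bw.
  by rewrite rowD addrC subrK; exact.
have cG : {within C, continuous (fun v => enorm (G v))}.
  apply: (@lipschitz_within_continuous _ _ R^o _ _ (L * d%:R)) => v w Cv Cw.
  apply: le_trans (enorm_dist_le _ _) _; apply: le_trans (G_lip _ _ Cv Cw) _.
  by rewrite -mulrA ler_wpM2l// enorm_le_norm.
have [v] := compact_EVT_min (ex_intro _ v0 Cv0) (@compact_enorm_ball _ _ _ _) cG.
rewrite inE => Cv minv.
(* Minimality gives [|G v - G v0| <= 2 * |G v0|], which the lower bound turns into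
   [|v - v0| <= 2 * lam * |G v0|]. *)
have v_int : enorm (v - v0) < eta.
  apply: le_lt_trans small; apply: le_trans (G_low _ _ Cv Cv0) _.
  rewrite -[leRHS]mulrA [leRHS]mulrCA ler_wpM2l ?(ltW lam0)//.
  apply: le_trans (enormB _ _) _.
  have := minv v0; rewrite inE => /(_ Cv0); rewrite /G; lra.
exists v => //; apply/eqP/contraT => xi0.
set xi := F _ in xi0.
have exi : 0 < enorm xi.
  by rewrite lt0r enorm_ge0 andbT; apply: contra xi0 => /eqP/enorm_eq0->.
have [u u1 uE] := partial_descent rho0 F_lip cPhi FPhi lam0 Phi_geT xi0.
pose a := enorm xi / lam; have a0 : 0 < a by rewrite divr_gt0.
have L21 : 0 < L ^+ 2 + 1 by rewrite ltr_wpDl// sqr_ge0.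
(* The first term keeps [w] in the closed ball; the second makes the gain, linear in [tau], exceed
   the quadratic error [L ^+ 2 * tau ^+ 2]. *)
pose tau := Num.min (eta - enorm (v - v0)) (a / (L ^+ 2 + 1)).
have tau0 : 0 < tau by rewrite lt_min subr_gt0 v_int divr_gt0.
pose w := v - tau *: u.
have Cw : C w.
  rewrite /C /w /= addrAC; apply: le_trans (enormB _ _) _.
  rewrite enormZ u1 mulr1 gtr0_norm// -lerBrDl.
  by rewrite /tau ge_min lexx.
have := uE (row_mx w y) tau (ltW tau0) (inball _ Cw).
rewrite rowD /w subrK -/w => /(_ (inball _ Cv)).
rewrite -/xi -/a -/(G w) => descent.
have step : enorm (xi - G w) <= L * tau.
  apply: le_trans (G_lip _ _ Cv Cw) _; rewrite ler_wpM2l// /w opprB addrCA subrr addr0.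
  by rewrite enormZ u1 mulr1 gtr0_norm.
have step2 : dot (xi - G w) (xi - G w) <= L ^+ 2 * tau ^+ 2.
  rewrite -sqr_enorm -exprMn ler_pXn2r// nnegrE ?enorm_ge0//.
  by rewrite mulr_ge0// ltW.
have min2 : dot xi xi <= dot (G w) (G w).
  rewrite -!sqr_enorm ler_pXn2r ?nnegrE ?enorm_ge0//.
  by have := minv w; rewrite inE; exact.
rewrite dotBl in descent; rewrite dotBl !dotBr in step2.
have dC := dotC xi (G w).
(* Twice [dot (xi - G w) xi] is at most the square of [|xi - G w|], the difference being
   [|G w|^2 - |xi|^2], nonnegative by minimality. *)
have key : 2 * (tau * a) <= L ^+ 2 * tau ^+ 2 by lra.
have : 2 * a <= L ^+ 2 * tau.
  by rewrite -(ler_pM2l tau0); move: key; rewrite expr2; lra.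
have : (L ^+ 2 + 1) * tau <= a.
  by rewrite mulrC -ler_pdivlMr// /tau ge_min lexx orbT.
by rewrite mulrDl mul1r; lra.
Qed.

Theorem theorem3p4 (R : realType) (d m : nat)
    (v0 : 'rV[R]_d) (y0 : 'rV[R]_m) (r : R) (r_gt0 : 0 < r)
    (F : 'rV[R]_(d + m) -> 'rV[R]_d) (LipF : R)
    (F_lip : lipschitz_const_on LipF (eball (row_mx v0 y0) r) F)
    (F0 : F (row_mx v0 y0) = 0)
    (dF_inv : mxset_invertible (gen_partial_jacobian F (row_mx v0 y0)))
    (dF_bnd : mxset_bounded
       (mxset_inv (gen_partial_jacobian F (row_mx v0 y0))))
    (s : R)
    (s_gt : 1 + (LipF + 1) *
       mxset_norm (mxset_inv (gen_partial_jacobian F (row_mx v0 y0))) < s) :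
  exists (eta : R) (g : 'rV[R]_m -> 'rV[R]_d),
    let B := eball y0 (eta / (2 * s)) in
    [/\ 0 < eta,
        {within B, continuous g}
      & forall y, B y -> eball v0 eta (g y)] /\
    [/\ g y0 = v0 /\
        (forall y, B y -> eball (row_mx v0 y0) r (row_mx (g y) y) /\
                          F (row_mx (g y) y) = 0),
        forall y, B y -> enorm (g y - g y0) <= s * enorm (y - y0)
      & 2^-1 * delta r ((s - 1) / (LipF + 1))
                 (gen_partial_jacobian F) (row_mx v0 y0) <= eta].
Proof.
have [L0 F_lip'] := F_lip.
set z0 := row_mx v0 y0 in F_lip F_lip' F0 dF_inv dF_bnd s_gt *.
set S := gen_partial_jacobian F in dF_inv dF_bnd s_gt *.
set lam := (s - 1) / (LipF + 1).
have L1 : 0 < LipF + 1 by rewrite ltr_wpDl.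
have M_lam : mxset_norm (mxset_inv (S z0)) < lam.
  by rewrite /lam ltr_pdivlMr// mulrC; lra.
have lam0 : 0 < lam by apply: le_lt_trans M_lam; exact: mxset_norm_ge0.
have s1 : 1 < s.
  by move: lam0; rewrite /lam pmulr_lgt0 ?invr_gt0// subr_gt0.
have s0 : 0 < s by lra.
have lamL : lam * (LipF + 1) = s - 1 by rewrite /lam divfK// gt_eqF.
have [e /andP[e0 er] eE] := hull_on_ball_regular r_gt0 F_lip dF_inv dF_bnd M_lam.
rewrite /delta; set Es := [set _ | _].
(* [Es] is nonempty and bounded by [r], so its [sup] is a true least upper bound. *)
have Ese : Es e by split => //; rewrite e0.
have Es_ub : has_ubound Es by exists r => e' [/andP[]].
have Es_sup : has_sup Es by split => //; exists e.
set dlt := sup Es.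
have e_dlt : e <= dlt by apply: ub_le_sup.
have dlt0 : 0 < dlt by apply: lt_le_trans e_dlt.
have dlt_r : dlt <= r by apply: ge_sup => [|e' [/andP[]]]; first by exists e.
pose eta := dlt / 2; have eta0 : 0 < eta by rewrite divr_gt0.
(* [|v - v0| <= eta] and [|y - y0| < eta / 2] place [(v, y)] within [rho] of the base point, and
   [rho < dlt] leaves an admissible [e'] above [rho], so the hull over the [rho]-ball obeys the
   bound [lam]. *)
pose rho := 3 / 2 * eta; have rho0 : 0 < rho by rewrite mulr_gt0.
have rho_dlt : rho < dlt by rewrite /rho /eta; lra.
have [e' Ese' rho_e'] : exists2 e', Es e' & rho < e'.
  by have [e' Ee' lt] := sup_adherent (ltac:(lra) : 0 < dlt - rho) Es_sup;
    exists e' => //; rewrite subKr in lt.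
have [_ /(_ rho)] := Ese'; rewrite (ltW rho0) rho_e' => /(_ isT) /=.
set Phi := hull_on_ball S z0 rho => -[Phi_unit Phi_bnd Phi_norm].
have Phi_op P : Phi P -> opnorm (invmx P) <= lam.
  by move=> PhiP; apply: le_trans Phi_norm; exact: mxset_inv_opnorm_le.
have Phi_ge P x : Phi P -> enorm x <= lam * enorm (x *m P^T).
  by move=> PhiP; apply: opnorm_inv_lower; [exact: Phi_unit|exact: Phi_op].
have Phi_geT P x : Phi P -> enorm x <= lam * enorm (x *m P).
  by move=> PhiP; apply: opnorm_inv_lower_tr; [exact: Phi_unit|exact: Phi_op].
have cPhi : @convex_set R 'M[R]_d Phi.
  by apply/convex_setP => P Q t t01 PhiP PhiQ; exact: convex_hull_convex.
have FPhi x : eball z0 rho x -> differentiable F x -> Phi (partial_jacobian F x).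
  move=> xrho dF; apply: sub_convex_hull; exists x => //.
  exact: gen_partial_jacobian_partial.
have ball_sub x : eball z0 rho x -> eball z0 r x.
  by rewrite !eballE// => xrho; apply: lt_trans xrho (lt_le_trans rho_dlt dlt_r).
have F_lip_rho : lipschitz_const_on LipF (eball z0 rho) F.
  by split => // x y /ball_sub xr /ball_sub yr; exact: F_lip'.
have eta2s : 0 < eta / (2 * s) by rewrite divr_gt0// mulr_gt0.
have eta2s_le : eta / (2 * s) <= eta / 2.
  by rewrite ler_wpM2l ?(ltW eta0)// lef_pV2 ?posrE ?mulr_gt0//; lra.
have BE y : eball y0 (eta / (2 * s)) y <-> enorm (y - y0) < eta / (2 * s) by exact: eballE.
have By0 : eball y0 (eta / (2 * s)) y0 by apply/BE; rewrite subrr enorm0.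
have inball y v : eball y0 (eta / (2 * s)) y -> enorm (v - v0) <= eta ->
    eball z0 rho (row_mx v y).
  move=> /BE yB vC; apply/eballE => //.
  rewrite /z0 opp_row_mx add_row_mx; apply: le_lt_trans (enorm_row_mx _ _) _.
  by rewrite /rho; lra.
have F_y v y y' : eball y0 (eta / (2 * s)) y -> eball y0 (eta / (2 * s)) y' ->
    enorm (v - v0) <= eta ->
    enorm (F (row_mx v y) - F (row_mx v y')) <= LipF * enorm (y - y').
  move=> yB y'B vC.
  apply: le_trans (F_lip' _ _ (ball_sub _ (inball _ _ yB vC)) (ball_sub _ (inball _ _ y'B vC))) _.
  by rewrite opp_row_mx add_row_mx subrr enorm_row_0mx.
have F_v v v' y : eball y0 (eta / (2 * s)) y -> enorm (v - v0) <= eta ->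
    enorm (v' - v0) <= eta ->
    enorm (v - v') <= lam * enorm (F (row_mx v y) - F (row_mx v' y)).
  move=> yB vC v'C.
  have := @partial_lower_bound _ _ _ F LipF lam rho z0 (row_mx v' y) (v - v') Phi
    rho0 F_lip_rho cPhi FPhi lam0 Phi_ge (inball _ _ yB v'C).
  by rewrite add_row_mx addr0 addrC subrK; apply; exact: inball.
have v0C : enorm (v0 - v0) <= eta by rewrite subrr enorm0 ltW.
have lamL_le x : 0 <= x -> lam * (LipF * x) <= (s - 1) * x.
  by move=> x0; rewrite -lamL mulrA ler_wpM2r// ler_wpM2l ?(ltW lam0)//; lra.
(* Outside the ball [v0] is a dummy value. The choice carries no continuity by itself; that comes
   from the lower bound [F_v], which also makes the zero unique. *)
have /choice[g gE] : forall y, exists v, eball y0 (eta / (2 * s)) y ->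
    enorm (v - v0) < eta /\ F (row_mx v y) = 0.
  move=> y; have [yB|yB] := pselect (eball y0 (eta / (2 * s)) y); last by exists v0.
  have [||v vB Fv] := @partial_zero_exists _ _ _ F LipF lam rho eta v0 z0 y Phi
    rho0 F_lip_rho cPhi FPhi lam0 Phi_ge Phi_geT eta0.
  - by move=> v vC; exact: inball.
  (* [2 * lam * |F(v0, y)| <= 2 * (s - 1) * |y - y0|], and [2 * s * |y - y0| < eta] on the ball. *)
  - have := F_y v0 y y0 yB By0 v0C; rewrite -/z0 F0 subr0 => Fy.
    have := ler_wpM2l (ltW lam0) Fy; have := lamL_le _ (enorm_ge0 (y - y0)).
    move/BE : yB; rewrite ltr_pdivlMr ?mulr_gt0// => yB.
    have := enorm_ge0 (y - y0); nra.
  - by exists v.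
(* Both [F(g y, y)] and [F(g y', y')] vanish, so the change of [F] from [g y] to [g y'] at fixed [y]
   has the size of its change from [y] to [y'] at fixed [g y']. *)
have g_lip y y' : eball y0 (eta / (2 * s)) y -> eball y0 (eta / (2 * s)) y' ->
    enorm (g y - g y') <= (s - 1) * enorm (y - y').
  move=> yB y'B; have [/ltW gy Fgy] := gE y yB; have [/ltW gy' Fgy'] := gE y' y'B.
  apply: le_trans (F_v _ _ _ yB gy gy') _.
  apply: le_trans (lamL_le _ (enorm_ge0 _)); rewrite ler_wpM2l ?(ltW lam0)//.
  by rewrite Fgy -Fgy' enorm_distC; exact: F_y.
have gy0 : g y0 = v0.
  have [/ltW gy Fgy] := gE y0 By0.
  apply/eqP; rewrite -subr_eq0; apply/eqP/enorm_eq0/eqP; rewrite eq_le enorm_ge0 andbT.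
  apply: le_trans (F_v _ _ _ By0 gy v0C) _.
  by rewrite Fgy -/z0 F0 subrr enorm0 mulr0.
exists eta, g; split; split => //.
- apply: (@lipschitz_within_continuous _ _ _ _ _ ((s - 1) * m%:R)) => y y' yB y'B.
  apply: le_trans (norm_le_enorm _) _; apply: le_trans (g_lip _ _ yB y'B) _.
  by rewrite -mulrA ler_wpM2l ?subr_ge0 ?(ltW s1)// enorm_le_norm.
- by move=> y yB; apply/eballE => //; have [] := gE y yB.
- split => // y yB; have [/ltW gy Fgy] := gE y yB; split => //.
  exact: ball_sub (inball _ _ yB gy).
- move=> y yB; apply: le_trans (g_lip _ _ yB By0) _.
  by rewrite ler_wpM2r ?enorm_ge0//; lra.
(* By the choice of [eta] the estimate (iii) is an equality. *)
- by rewrite mulrC.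
Qed.
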